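(* Let $p$ be a balanced ip-function generator on weighted graphs, and let $(G,f)$, $(G',f')$ be two weighted graphs. Let $D(f)$ and $D(f')$ be the persistence diagrams of the ip-functions $p_{(G,f)}$ and $p_{(G',f')}$. Then \[ d\big(D(f),D(f')\big)\le \delta\big((G,f),(G',f')\big), \] where $d$ is the bottleneck distance and $\delta$ the natural pseudodistance.
   Context: Graphs are finite simple undirected graphs $G=(V,E)$. A weighted graph is a pair $(G,f)$ with $f:E\to\mathbb{R}$. For $u\in\mathbb{R}$, $G_u$ denotes the subgraph of $G$ induced by the edge set $f^{-1}((-\infty,u])$ (its vertices are the endpoints of these edges), and $G_{+\infty}=G$. Let $\Delta^+=\{(u,v)\in\mathbb{R}\times(\mathbb{R}\cup\{+\infty\}) : u<v\}$ and $\Delta=\{(u,u)\}$. A categorical persistence function (on $(\mathbb{R},\le)$) is a lower-bounded function $p:\Delta^+\to\mathbb{Z}$ such that for all $u_1\le u_2<v_1\le v_2$: (1) $p(u_1,v_1)\le p(u_2,v_1)$ and $p(u_2,v_2)\le p(u_2,v_1)$; (2) $p(u_2,v_1)-p(u_1,v_1)\ge p(u_2,v_2)-p(u_1,v_2)$. An ip-function generator is a map $p$ assigning to every weighted graph $(G,f)$ a categorical persistence function $p_{(G,f)}$ (called an ip-function), such that $p_{(G,f)}=p_{(G',f')}$ whenever the filtrations $\{G_u\}$ and $\{G'_u\}$ are naturally isomorphic (e.g. when there is a graph isomorphism $\psi:G\to G'$ with $f=f'\circ\psi$). It is balanced if: whenever $(G,f)$, $(G',f')$ are weighted graphs, $\psi:G\to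 G'$ is a graph isomorphism and $h>0$ satisfies $\sup_{e\in E}|f(e)-f'(\psi(e))|\le h$, then $p_{(G,f)}(u-h,v+h)\le p_{(G',f')}(u,v)$ for all $(u,v)\in\Delta^+$ (with $+\infty+h=+\infty$). Persistence diagram of a categorical persistence function $p$: for $(u,v)\in\Delta^+$ with $v<\infty$, its multiplicity is $\mu(u,v)=\min_{\varepsilon>0,\,u+\varepsilon<v-\varepsilon}\big[p(u+\varepsilon,v-\varepsilon)-p(u-\varepsilon,v-\varepsilon)-p(u+\varepsilon,v+\varepsilon)+p(u-\varepsilon,v+\varepsilon)\big]$, and $\mu(u,+\infty)=\min_{\varepsilon>0,\,u+\varepsilon<1/\varepsilon}\big[p(u+\varepsilon,1/\varepsilon)-p(u-\varepsilon,1/\varepsilon)\big]$. The diagram is the multiset consisting of the points of $\Delta^+$ with multiplicity $\mu$ (cornerpoints) together with all points of $\Delta$, each with infinite multiplicity. Bottleneck distance: $d(D,D')=\inf_{\gamma}\sup_{x\in D}\|x-\gamma(x)\|_\infty$, the infimum over all bijections $\gamma:D\to D'$ of multisets (with $\infty-\infty=0$). Natural pseudodistance: $\delta((G,f),(G',f'))=+\infty$ if there is no graph isomorphism $G\to G'$; otherwise $\delta=\inf_{\phi}\sup_{e\in E}|f(e)-f'(\phi(e))|$, the infimum over graph isomorphisms $\phi:G\to G'$. *)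

(* Defs.v *)
From HB Require Import structures.
From mathcomp Require Import all_boot all_order all_algebra.
From mathcomp Require Import all_classical all_reals all_analysis.

Set Implicit Arguments.
Unset Strict Implicit.
Unset Printing Implicit Defensive.

Import Order.TTheory GRing.Theory Num.Theory.
Local Open Scope classical_set_scope.
Local Open Scope ring_scope.

(* The vertex set is a finType, adjacency is a symmetric irreflexive   *)
(* relation; edges are the 2-element sets {x,y} with adj x y; the      *)
(* weight f : E -> R is given as a function on {set V} of which only   *)
(* the values on edges are ever used.                                  *)
Record wgraph (R : realType) := WGraph {
  vtx : finType;
  adj : rel vtx;
  adj_sym : symmetric adj;
  adj_irr : irreflexive adj;
  wt : {set vtx} -> R }.

Arguments vtx {R} w : rename.
Arguments adj {R} w : rename.
Arguments wt {R} w : rename.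

Unset Implicit Arguments.

Section Defs.
Context {R : realType}.

Definition is_edge (G : wgraph R) (e : {set vtx G}) : Prop :=
  exists x y, adj G x y /\ e = [set x; y]%SET.

(* filtration index: Some u = u \in R, None = +oo *)
Definition ole (u v : option R) : Prop :=
  match v with
  | None => True
  | Some s => match u with Some r => r <= s | None => False end
  end.

Definition sub_edge (G : wgraph R) (u : option R) (e : {set vtx G}) : Prop :=
  is_edge G e /\ (match u with Some r => wt G e <= r | None => True end).

(* vertices of G_u : endpoints of the edges of G_u; G_{+oo} = G *)
Definition sub_vtx (G : wgraph R) (u : option R) (x : vtx G) : Prop :=
  match u with
  | None => True
  | Some _ => exists y, sub_edge G u [set x; y]%SET
  end.

Definition nat_iso (G G' : wgraph R) : Prop :=
  exists phi : option R -> vtx G -> vtx G',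
    (forall u,
       (forall x, sub_vtx G u x -> sub_vtx G' u (phi u x)) /\
       (forall x y, sub_vtx G u x -> sub_vtx G u y -> phi u x = phi u y -> x = y) /\
       (forall y', sub_vtx G' u y' -> exists x, sub_vtx G u x /\ phi u x = y') /\
       (forall x y, sub_vtx G u x -> sub_vtx G u y ->
          (sub_edge G u [set x; y]%SET <-> sub_edge G' u [set phi u x; phi u y]%SET))) /\
    (forall u v x, ole u v -> sub_vtx G u x -> phi v x = phi u x).

Definition giso (G G' : wgraph R) (psi : vtx G -> vtx G') : Prop :=
  bijective psi /\ forall x y, adj G' (psi x) (psi y) = adj G x y.

(* categorical persistence function on Delta^+ = {(u,v) | u < v},
   u \in R, v \in R \cup {+oo} (v : \bar R with u%:E < v). *)
Definition cpf (p : R -> \bar R -> int) : Prop :=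
  (exists m : int, forall u v, (u%:E < v)%E -> m <= p u v) /\
  (forall u1 u2 v1 v2, u1 <= u2 -> (u2%:E < v1)%E -> (v1 <= v2)%E ->
     [/\ p u1 v1 <= p u2 v1, p u2 v2 <= p u2 v1 &
         p u2 v2 - p u1 v2 <= p u2 v1 - p u1 v1]).

Definition ip_generator (p : forall G : wgraph R, R -> \bar R -> int) : Prop :=
  (forall G, cpf (p G)) /\
  (forall G G', nat_iso G G' -> forall u v, (u%:E < v)%E -> p G u v = p G' u v).

Definition balanced (p : forall G : wgraph R, R -> \bar R -> int) : Prop :=
  forall (G G' : wgraph R) (psi : vtx G -> vtx G'), giso G G' psi ->
  forall h : R, 0 < h ->
  (forall e, is_edge G e -> `|wt G e - wt G' (psi @: e)%SET| <= h) ->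
  forall u v, (u%:E < v)%E -> p G (u - h) (v + h%:E)%E <= p G' u v.

Definition mult_fin (p : R -> \bar R -> int) (u v : R) (m : int) : Prop :=
  let E eps := p (u + eps) (v - eps)%:E - p (u - eps) (v - eps)%:E
               - p (u + eps) (v + eps)%:E + p (u - eps) (v + eps)%:E in
  (exists eps, [/\ 0 < eps, u + eps < v - eps & E eps = m]) /\
  (forall eps, 0 < eps -> u + eps < v - eps -> m <= E eps).

Definition mult_inf (p : R -> \bar R -> int) (u : R) (m : int) : Prop :=
  let E eps := p (u + eps) (eps^-1)%:E - p (u - eps) (eps^-1)%:E in
  (exists eps, [/\ 0 < eps, u + eps < eps^-1 & E eps = m]) /\
  (forall eps, 0 < eps -> u + eps < eps^-1 -> m <= E eps).

Definition mult (p : R -> \bar R -> int) (u : R) (v : \bar R) (m : int) : Prop :=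
  match v with
  | EFin r => mult_fin p u r m
  | EPInf => mult_inf p u m
  | ENInf => False
  end.

(* The persistence diagram as a multiset: its elements are copies (x, n),
   x a point, n : nat an index of the copy.  A cornerpoint x in Delta^+
   has copies n < mu(x); a diagonal point (u,u) has copies for all n. *)
Definition Dgm (p : R -> \bar R -> int) : set ((R * \bar R) * nat) :=
  fun z => (z.1.2 = z.1.1%:E) \/
           ((z.1.1%:E < z.1.2)%E /\ exists m : int, mult p z.1.1 z.1.2 m /\ (z.2%:Z < m)).

Definition edist (a b : \bar R) : \bar R :=
  match a, b with
  | EFin r, EFin s => (`|r - s|)%:E
  | EPInf, EPInf => 0%E
  | ENInf, ENInf => 0%E
  | _, _ => +oo%E
  end.

Definition pdist (x y : R * \bar R) : \bar R :=
  Order.max ((`|x.1 - y.1|)%:E) (edist x.2 y.2).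

Definition bottleneck (D D' : set ((R * \bar R) * nat)) : \bar R :=
  ereal_inf [set c | exists gamma : (R * \bar R) * nat -> (R * \bar R) * nat,
    [/\ (forall z, D z -> D' (gamma z)),
        (forall z1 z2, D z1 -> D z2 -> gamma z1 = gamma z2 -> z1 = z2),
        (forall z', D' z' -> exists z, D z /\ gamma z = z') &
        c = ereal_sup [set pdist z.1 (gamma z).1 | z in D]]].

(* natural pseudodistance (sup over the edge set, taken to be 0 if E is empty) *)
Definition nat_pseudodist (G G' : wgraph R) : \bar R :=
  if `[< exists psi : vtx G -> vtx G', giso G G' psi >] then
    ereal_inf [set c | exists psi : vtx G -> vtx G', giso G G' psi /\
      c = ereal_sup (0%E |` [set (`|wt G e - wt G' (psi @: e)%SET|)%:E | e in is_edge G])]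
  else +oo%E.

End Defs.

(* Main.v *)
Require Import Defs.
From HB Require Import structures.
From mathcomp Require Import all_boot all_order all_algebra.
From mathcomp Require Import all_classical all_reals all_analysis.
From mathcomp Require Import lra zify.

(** Interpolate the weights, f_t = (1 - t) f + t (f' o psi), along a graph
    isomorphism psi for which |f - f' o psi| <= H.  Balancedness makes the
    rank functions q_s and q_t interleaved at scale |s - t| H.

    An interleaving alone does not bound the bottleneck distance by its scale,
    but it does so locally: q_t0 is constant on the four open quadrants of a
    small box around a point k, so an interleaving at a scale small compared
    with the box forces q_t to have the same mass as q_t0 on smaller boxes
    around k, that is, exactly mu(k) cornerpoints near k.  A finite set of
    cornerpoints of persistence > 2c, with c > H, can therefore be followed
    injectively from t = 0 to t = 1 at speed c, by a supremum argument.  An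
    ultrafilter glues these finite injections, the remaining cornerpoints go to
    the diagonal, and a Cantor-Bernstein argument turns the injections in both
    directions into a bijection of cost at most c. *)

Set Implicit Arguments.
Unset Strict Implicit.
Unset Printing Implicit Defensive.

Import Order.TTheory GRing.Theory Num.Theory.
Local Open Scope classical_set_scope.
Local Open Scope ring_scope.

(** * Monotone integer-valued functions on real intervals *)

Section MonotoneIntegerFunctions.
Context {R : realType}.

Lemma exists_margin (a x b : R) : a < x -> x < b ->
  exists e, [/\ 0 < e, a < x - e & x + e < b].
Proof.
move=> ax xb; pose e := Num.min (x - a) (b - x).
have e0 : 0 < e by rewrite lt_min !subr_gt0 ax.
have e1 : e <= x - a by rewrite ge_min lexx.
have e2 : e <= b - x by rewrite ge_min lexx orbT.
by exists (e / 2); split; lra.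
Qed.

Definition mono_on (f : R -> int) (a b : R) : Prop :=
  forall x y, a <= x -> x <= y -> y <= b -> f x <= f y.

Lemma mono_on_sub f a b a' b' :
  a <= a' -> b' <= b -> mono_on f a b -> mono_on f a' b'.
Proof. by move=> aa' bb' fm x y ax xy yb; apply: fm; lra. Qed.

(** Bisection, by induction on the total increase: either [f] is constant on the left half, or its
    increase on the right half is strictly smaller. *)
Lemma exists_regular_point (f : R -> int) a b : a < b -> mono_on f a b ->
  exists m e, [/\ 0 < e, a <= m - e, m + e <= b & f (m - e) = f (m + e)].
Proof.
move=> ab fm.
have [n fn] : exists n : nat, f b - f a <= n%:Z by exists `|f b - f a|%N; lia.
elim: n a b ab fm fn => [|n IHn] a b ab fm fn.
  exists ((a + b) / 2), ((b - a) / 2); split; try lra.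
  have -> : (a + b) / 2 - (b - a) / 2 = a by lra.
  have -> : (a + b) / 2 + (b - a) / 2 = b by lra.
  by have := fm a b ltac:(lra) ltac:(lra) ltac:(lra); lia.
pose m := (a + b) / 2.
have am : a < m by rewrite /m; lra.
have mb : m < b by rewrite /m; lra.
have fam := fm a m ltac:(lra) ltac:(lra) ltac:(lra).
have fmb := fm m b ltac:(lra) ltac:(lra) ltac:(lra).
have [e|ne] := eqVneq (f a) (f m).
  exists ((a + m) / 2), ((m - a) / 2); split; try lra.
  have -> : (a + m) / 2 - (m - a) / 2 = a by lra.
  by have -> : (a + m) / 2 + (m - a) / 2 = m by lra.
have := IHn m b mb (mono_on_sub (ltW am) (lexx _) fm) ltac:(lia).
by move=> [x [e [e0 h1 h2 h3]]]; exists x, e; split => //; lra.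
Qed.

(** Moving the left end to a point where [f] exceeds [f a] lowers the total increase, so this
    happens only finitely often. *)
Lemma left_constant (f : R -> int) a b : a < b -> mono_on f a b ->
  exists x0, [/\ a <= x0, x0 < b & forall x, x0 <= x -> x < b -> f x = f x0].
Proof.
move=> ab fm.
have [n fn] : exists n : nat, f b - f a <= n%:Z by exists `|f b - f a|%N; lia.
elim: n a b ab fm fn => [|n IHn] a b ab fm fn.
  exists a; split => // x ax xb.
  by have := fm a x ltac:(lra) ltac:(lra) ltac:(lra);
     have := fm x b ltac:(lra) ltac:(lra) ltac:(lra); lia.
have [[x [ax xb fx]]|nex] := pselect (exists x, [/\ a <= x, x < b & f a < f x]).
  have := IHn x b xb (mono_on_sub ax (lexx _) fm) ltac:(lia).
  by move=> [x0 [h1 h2 h3]]; exists x0; split => //; lra.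
exists a; split => // x ax xb.
have := fm a x ltac:(lra) ltac:(lra) ltac:(lra).
rewrite le_eqVlt => /orP[/eqP//|fax]; exfalso; apply: nex.
by exists x.
Qed.

Lemma right_constant (f : R -> int) a b : a < b -> mono_on f a b ->
  exists x0, [/\ a < x0, x0 <= b & forall x, a < x -> x <= x0 -> f x = f x0].
Proof.
move=> ab fm.
have gm : mono_on (fun x => - f (- x)) (- b) (- a).
  by move=> x y bx xy ya; rewrite lerN2; apply: fm; lra.
have ba : - b < - a by rewrite ltrN2.
have [x0 [h1 h2 h3]] := left_constant ba gm.
exists (- x0); split; try lra.
move=> x ax xx0; have := h3 (- x) ltac:(lra) ltac:(lra).
by rewrite opprK => /oppr_inj.
Qed.

Lemma constant_on_both_sides (f : R -> int) a b u :
  a < u -> u < b -> mono_on f a b ->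
  exists r, [/\ 0 < r, a <= u - r, u + r <= b,
    forall x y, u - r <= x -> x < u -> u - r <= y -> y < u -> f x = f y &
    forall x y, u < x -> x <= u + r -> u < y -> y <= u + r -> f x = f y].
Proof.
move=> au ub fm.
have [x1 [h1 h2 h3]] := left_constant au (mono_on_sub (lexx a) (ltW ub) fm).
have [x2 [h4 h5 h6]] := right_constant ub (mono_on_sub (ltW au) (lexx b) fm).
pose r := Num.min (u - x1) (x2 - u).
have r1 : r <= u - x1 by rewrite /r ge_min lexx.
have r2 : r <= x2 - u by rewrite /r ge_min lexx orbT.
have r0 : 0 < r by rewrite /r lt_min; apply/andP; split; lra.
exists r; split; try lra.
- by move=> x y ? ? ? ?; rewrite h3 ?(h3 y) //; lra.
- by move=> x y ? ? ? ?; rewrite h6 ?(h6 y) //; lra.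
Qed.

Lemma stabilizes_at_infinity (f : R -> int) (a : R) (m : int) :
  (forall x, a <= x -> m <= f x) ->
  (forall x y, a <= x -> x <= y -> f y <= f x) ->
  exists c, a <= c /\ forall y, c <= y -> f y = f c.
Proof.
move=> fm.
have [n fn] : exists n : nat, f a - m <= n%:Z by exists `|f a - m|%N; lia.
elim: n a fm fn => [|n IHn] a fm fn fd.
  exists a; split => // y ay.
  by have := fd a y ltac:(lra) ay; have := fm y ay; lia.
have [[x [ax fx]]|nex] := pselect (exists x, a <= x /\ f x < f a).
  have [||] := IHn x _ ltac:(lia).
  - by move=> y xy; apply: fm; lra.
  - by move=> y z xy yz; apply: fd; lra.
  by move=> c [h1 h2]; exists c; split => //; lra.
exists a; split => // y ay; have := fd a y (lexx _) ay.
rewrite le_eqVlt => /orP[/eqP//|fax]; exfalso; apply: nex.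
by exists y.
Qed.

(** Let [u] be the supremum of the level set of [f a]. A value below [f b] to the right of [u]
    yields a flat spot at an intermediate height, and cutting there leaves fewer jumps on each side.
    Otherwise all the variation sits at [u]. *)
Lemma atom_or_cut (f : R -> int) a b : a < b -> mono_on f a b ->
  (exists2 e, 0 < e & forall x, a <= x -> x <= a + e -> f x = f a) ->
  (exists2 e, 0 < e & forall x, b - e <= x -> x <= b -> f x = f b) ->
  (exists u, [/\ a < u, u < b,
     forall x, a <= x -> x < u -> f x = f a &
     forall x, u < x -> x <= b -> f x = f b]) \/
  (exists m e, [/\ a < m - e, m + e < b, 0 < e, f (m - e) = f (m + e) &
     f a < f (m - e) /\ f (m + e) < f b]).
Proof.
move=> ab fm [e1' e1'0 fe1'] [e2' e2'0 fe2'].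
have [e1 [e10 e1b fe1]] : exists e1, [/\ 0 < e1, a + e1 <= b & f (a + e1) = f a].
  exists (Num.min (b - a) e1'); split; first by rewrite lt_min subr_gt0 ab.
    have : Num.min (b - a) e1' <= b - a by rewrite ge_min lexx.
    by lra.
  have h1 : Num.min (b - a) e1' <= e1' by rewrite ge_min lexx orbT.
  have h2 : 0 < Num.min (b - a) e1' by rewrite lt_min subr_gt0 ab.
  by apply: fe1'; lra.
have [e2 [e20 e2a fe2]] : exists e2, [/\ 0 < e2, a <= b - e2 & f (b - e2) = f b].
  exists (Num.min (b - a) e2'); split; first by rewrite lt_min subr_gt0 ab.
    have : Num.min (b - a) e2' <= b - a by rewrite ge_min lexx.
    by lra.
  have h1 : Num.min (b - a) e2' <= e2' by rewrite ge_min lexx orbT.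
  have h2 : 0 < Num.min (b - a) e2' by rewrite lt_min subr_gt0 ab.
  by apply: fe2'; lra.
have [fab|nfab] := eqVneq (f a) (f b).
  have fx x : a <= x -> x <= b -> f x = f a.
    by move=> ax xb; apply/eqP; rewrite eq_le {1}fab !fm.
  left; exists ((a + b) / 2); split; try lra.
    by move=> x ax xu; rewrite fx //; lra.
  by move=> x xu xb; rewrite fx //; lra.
have ltfab : f a < f b.
  by rewrite lt_neqAle nfab fm // ltW.
pose A := [set x | [/\ a <= x, x <= b & f x = f a]].
have A0 : A (a + e1) by split => //; lra.
have Aub : has_ubound A by exists b => x [].
have Asup : has_sup A by split => //; exists (a + e1).
pose u := sup A.
have ae1u : a + e1 <= u by apply: ub_le_sup.
have fl x : a <= x -> x < u -> f x = f a.
  move=> ax xu.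
  have ux : 0 < u - x by lra.
  have [y [ay yb fy] xy] := sup_adherent ux Asup.
  have := fm a x (lexx _) ax; have := fm x y ax; rewrite -/u in xy *.
  move=> /(_ ltac:(lra) yb) h1 h2.
  by apply/eqP; rewrite eq_le -{1}fy h1 h2 //; lra.
have fr x : u < x -> x <= b -> f a < f x.
  move=> ux xb; have := fm a x (lexx _) ltac:(lra) xb.
  rewrite le_eqVlt => /orP[/eqP fx|//].
  have : x <= u by apply: ub_le_sup => //; split => //; lra.
  by rewrite leNgt ux.
have [[x [ux xb fx]]|nex] :=
  pselect (exists x, [/\ u < x, x <= b & f x < f b]).
  right.
  (* Searching only to the right of [(u + x) / 2] keeps the flat spot away from [u], hence at a
     height above [f a]. *)
  have uxm : (u + x) / 2 < x by lra.
  have [|m [e [e0 h1 h2 h3]]] := @exists_regular_point f _ _ uxm.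
    by apply: mono_on_sub fm; lra.
  have h4 : f (m + e) <= f x by apply: fm; lra.
  exists m, e; split => //; try lra.
    rewrite lt_neqAle; apply/andP; split; last lra.
    by apply/eqP => E; move: h4; rewrite E leNgt fx.
  split; last exact: le_lt_trans h4 fx.
  by apply: fr; lra.
left; exists u; split => //; first lra.
  have : u <= b - e2; last by lra.
  rewrite leNgt; apply/negP => h.
  by move: nfab; rewrite -fe2 (fl _ e2a h) eqxx.
move=> x ux xb; have := fm x b ltac:(lra) xb (lexx _).
by rewrite le_eqVlt => /orP[/eqP//|fx]; exfalso; apply: nex; exists x.
Qed.

End MonotoneIntegerFunctions.

(** * Masses of rectangles, regular lines and multiplicities *)

Section RankFunctions.
Context {R : realType}.
Implicit Types (p q : R -> \bar R -> int) (a b c d e u v x y : R).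

Lemma cpfE p u1 u2 v1 v2 : cpf p -> u1 <= u2 -> u2 < v1 -> v1 <= v2 ->
  [/\ p u1 v1%:E <= p u2 v1%:E, p u2 v2%:E <= p u2 v1%:E &
      p u2 v2%:E - p u1 v2%:E <= p u2 v1%:E - p u1 v1%:E].
Proof. by move=> [_ pP] u12 uv v12; apply: pP; rewrite ?lte_fin ?lee_fin. Qed.

Lemma cpf_monox p b c a : cpf p -> b < c -> mono_on (fun x => p x c%:E) a b.
Proof. by move=> pP bc x y _ xy yb; have [] := cpfE pP xy (le_lt_trans yb bc) (lexx c). Qed.

Lemma cpf_monoy p b c d : cpf p -> b < c -> mono_on (fun y => - p b y%:E) c d.
Proof.
move=> pP bc x y cx xy _; rewrite lerN2.
by have [] := cpfE pP (lexx b) (lt_le_trans bc cx) xy.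
Qed.

(** Condition (2) makes the increment in the abscissa shrink as the ordinate grows, and (1) keeps it
    nonnegative, so once zero it stays zero. *)
Lemma cpf_eqx p x x' c y : cpf p -> x <= x' -> x' < c -> c <= y ->
  p x c%:E = p x' c%:E -> p x y%:E = p x' y%:E.
Proof.
move=> pP xx' x'c cy E; have [_ _ h] := cpfE pP xx' x'c cy.
have [h' _ _] := cpfE pP xx' (lt_le_trans x'c cy) (lexx y).
by lra.
Qed.

Lemma cpf_eqy p x b y y' : cpf p -> x <= b -> b < y -> y <= y' ->
  p b y%:E = p b y'%:E -> p x y%:E = p x y'%:E.
Proof.
move=> pP xb bY yy' E; have [_ _ h] := cpfE pP xb bY yy'.
have [_ h' _] := cpfE pP (lexx x) (le_lt_trans xb bY) yy'.
by lra.
Qed.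

(** The alternating sum in the definition of the multiplicity, on an arbitrary rectangle. When the
    sides are regular it counts the cornerpoints inside ([box_count]). *)
Definition bmass p a b c d : int :=
  p b c%:E - p a c%:E - p b d%:E + p a d%:E.

Lemma bmass_ge0 p a b c d : cpf p -> a <= b -> b < c -> c <= d ->
  0 <= bmass p a b c d.
Proof. by move=> pP ab bc cd; have [_ _ h] := cpfE pP ab bc cd; rewrite /bmass; lra. Qed.

(** The complement of the small rectangle in the large one splits into four rectangles of
    nonnegative mass. *)
Lemma bmass_le p a b c d a' b' c' d' : cpf p ->
  a' <= a -> a <= b -> b <= b' -> b' < c' -> c' <= c -> c <= d -> d <= d' ->
  bmass p a b c d <= bmass p a' b' c' d'.
Proof.
move=> pP a'a ab bb' b'c' c'c cd dd'.
have := @bmass_ge0 p a' a c' d' pP a'a ltac:(lra) ltac:(lra).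
have := @bmass_ge0 p b b' c' d' pP bb' ltac:(lra) ltac:(lra).
have := @bmass_ge0 p a b c' c pP ab ltac:(lra) ltac:(lra).
have := @bmass_ge0 p a b d d' pP ab ltac:(lra) ltac:(lra).
by rewrite /bmass; lra.
Qed.

(** By [xregE] the constancy at ordinate [c] persists at all higher ordinates, so the vertical ray
    above [(a, c)] meets no jump. [yreg] is the analogue for the horizontal ray to the left of
    [(b, c)]. *)
Definition xreg p c a : Prop := exists e, [/\ 0 < e, a + e < c &
  forall x, a - e <= x -> x <= a + e -> p x c%:E = p a c%:E].

Definition yreg p b c : Prop := exists e, [/\ 0 < e, b < c - e &
  forall y, c - e <= y -> y <= c + e -> p b y%:E = p b c%:E].

Lemma xregE p c a : cpf p -> xreg p c a -> exists e, [/\ 0 < e, a + e < c &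
  forall x y, a - e <= x -> x <= a + e -> c <= y -> p x y%:E = p a y%:E].
Proof.
move=> pP [e [e0 aec h]]; exists e; split => // x y aex xae cy.
have [xa|ax] := lerP x a.
  by apply: (cpf_eqx pP xa _ cy); [lra|exact: h].
by apply/esym/(cpf_eqx pP (ltW ax) _ cy); [lra|exact/esym/h].
Qed.

Lemma yregE p b c : cpf p -> yreg p b c -> exists e, [/\ 0 < e, b < c - e &
  forall x y, x <= b -> c - e <= y -> y <= c + e -> p x y%:E = p x c%:E].
Proof.
move=> pP [e [e0 aec h]]; exists e; split => // x y xb cey yce.
have [yc|cy] := lerP y c.
  by apply: (cpf_eqy pP xb _ yc); [lra|exact: h].
by apply/esym/(cpf_eqy pP xb _ (ltW cy)); [lra|exact/esym/h].
Qed.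

Lemma xreg_le p c c' a : cpf p -> c <= c' -> xreg p c a -> xreg p c' a.
Proof.
move=> pP cc' /(xregE pP)[e [e0 h1 h2]]; exists e; split => //; first lra.
by move=> x ? ?; apply: h2.
Qed.

Lemma yreg_le p b b' c : cpf p -> b' <= b -> yreg p b c -> yreg p b' c.
Proof.
move=> pP cc' /(yregE pP)[e [e0 h1 h2]]; exists e; split => //; first lra.
by move=> x ? ?; apply: h2.
Qed.

Lemma xregI p c m e : cpf p -> 0 < e -> m + e < c ->
  p (m - e) c%:E = p (m + e) c%:E -> xreg p c m.
Proof.
move=> pP e0 mec E.
have fm := cpf_monox (a := m - e) pP mec.
have K x : m - e <= x -> x <= m + e -> p x c%:E = p (m + e) c%:E.
  by move=> h1 h2; apply/eqP; rewrite eq_le -{2}E !fm //; lra.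
by exists e; split => // x h1 h2; rewrite !K //; lra.
Qed.

Lemma yregI p b m e : cpf p -> 0 < e -> b < m - e ->
  p b (m - e)%:E = p b (m + e)%:E -> yreg p b m.
Proof.
move=> pP e0 mec E.
have fm x y : m - e <= x -> x <= y -> p b y%:E <= p b x%:E.
  by move=> h1 h2; have [] := cpfE pP (lexx b) (lt_le_trans mec h1) h2.
have K x : m - e <= x -> x <= m + e -> p b x%:E = p b (m + e)%:E.
  by move=> h1 h2; apply/eqP; rewrite eq_le -{1}E !fm //; lra.
by exists e; split => // x h1 h2; rewrite !K //; lra.
Qed.

Lemma xreg_exists p a b c : cpf p -> a < b -> b < c ->
  exists m, [/\ a < m, m < b & xreg p c m].
Proof.
move=> pP ab bc.
have [m [e [e0 h1 h2 h3]]] := exists_regular_point ab (cpf_monox (a := a) pP bc).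
by exists m; split; [lra|lra|apply: (xregI pP e0) => //; lra].
Qed.

Lemma yreg_exists p b c d : cpf p -> b < c -> c < d ->
  exists m, [/\ c < m, m < d & yreg p b m].
Proof.
move=> pP bc cd.
have [m [e [e0 h1 h2 h3]]] := exists_regular_point cd (cpf_monoy (d := d) pP bc).
by exists m; split; [lra|lra|apply: (yregI pP e0) => //; [lra|exact: oppr_inj]].
Qed.

Lemma exists_small_inverse (c r : R) : 0 < r ->
  exists e, [/\ 0 < e, e <= r & forall e', 0 < e' -> e' <= e -> c <= e'^-1].
Proof.
move=> r0; have c1 : 0 < `|c| + 1 by rewrite ltr_wpDl.
exists (Num.min r (`|c| + 1)^-1); split.
- by rewrite lt_min r0 invr_gt0.
- by rewrite ge_min lexx.
- move=> e' e'0; rewrite le_min => /andP[_ h].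
  have h' : `|c| + 1 <= e'^-1 by rewrite -[leLHS]invrK lef_pV2 // posrE ?invr_gt0.
  by apply: le_trans (ler_norm c) _; lra.
Qed.

(** The mass of the square around [(u, v)] does not increase as [e] shrinks, so its value for small
    [e] is the minimum. *)
Lemma mult_finI p u v e0 (m : int) : cpf p -> 0 < e0 -> u + e0 < v - e0 ->
  (forall e, 0 < e -> e <= e0 -> bmass p (u - e) (u + e) (v - e) (v + e) = m) ->
  mult_fin p u v m.
Proof.
move=> pP e00 uv h; split.
  by exists e0; split => //; apply: h.
move=> e e_gt0 uev; have [ee0|e0e] := lerP e e0; first by rewrite -(h e).
by rewrite -(h e0) //; apply: bmass_le => //; lra.
Qed.

Lemma mult_infI p u e0 (m : int) : cpf p -> 0 < e0 ->
  (forall e, 0 < e -> e <= e0 -> u + e < e^-1) ->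
  (forall e, 0 < e -> e <= e0 ->
     p (u + e) (e^-1)%:E - p (u - e) (e^-1)%:E = m) ->
  mult_inf p u m.
Proof.
move=> pP e00 uv h; split.
  by exists e0; split => //; [apply: uv|apply: h].
move=> e e_gt0 uev; have [ee0|e0e] := lerP e e0; first by rewrite -(h e).
rewrite -(h e0) //.
(* Passing from [e] to [e0] raises the ordinate and narrows the range of abscissae; neither can
   enlarge the increment. *)
have ie : e^-1 <= e0^-1 by rewrite lef_pV2 ?posrE // ltW.
have ue0 := uv _ e00 (lexx _).
have [_ _ h1] := @cpfE p (u - e) (u + e) _ _ pP ltac:(lra) uev ie.
have [h2 _ _] := @cpfE p (u + e0) (u + e) _ _ pP ltac:(lra) (lt_le_trans uev ie) (lexx _).
have ue0' : u - e0 < e0^-1 by lra.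
have [h3 _ _] := @cpfE p (u - e) (u - e0) _ _ pP ltac:(lra) ue0' (lexx _).
by lra.
Qed.

Lemma mult_uniq p u (v : \bar R) (m m' : int) : mult p u v m -> mult p u v m' -> m = m'.
Proof.
case: v => [v||] //= [[e [h1 h2 h3]] h4] [[e' [h1' h2' h3']] h4'].
  have := h4 e' h1' h2'; have := h4' e h1 h2; rewrite h3 h3' => ? ?.
  exact/le_anti/andP.
have := h4 e' h1' h2'; have := h4' e h1 h2; rewrite h3 h3' => ? ?.
exact/le_anti/andP.
Qed.

(** Near a regular abscissa the terms at [u + eps] and [u - eps] cancel for small [eps], so the
    multiplicity is at most 0 and there is no copy. *)
Lemma xreg_no_point p c (z : R * \bar R * nat) : cpf p -> Dgm p z ->
  (c%:E < z.1.2)%E -> xreg p c z.1.1 -> False.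
Proof.
move: z => [[u v] n] pP /= [/= E cv [e [e0 h _]]|/= [uv [m [mm nm]]] cv].
  by move: cv; rewrite E lte_fin; lra.
move=> /(xregE pP)[e [e0 uec h]].
case: v uv mm cv => [v||] //=; rewrite ?lte_fin.
  move=> uv [_ mm] cv.
  (* The three bounds keep the abscissae in the flat range, [v - e'] at or above [c], and [u + e']
     below [v - e']. *)
  pose e' := Num.min e (Num.min (v - c) ((v - u) / 3)).
  have e'0 : 0 < e' by rewrite /e' !lt_min e0; apply/andP; split; lra.
  have e'e : e' <= e by rewrite /e' ge_min lexx.
  have e'v : e' <= v - c by rewrite /e' !ge_min lexx orbT.
  have e'u : e' <= (v - u) / 3 by rewrite /e' !ge_min lexx !orbT.
  have := mm e' e'0 ltac:(lra).
  rewrite !(h (u + e')) ?(h (u - e')); try lra.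
  by clear -nm; lia.
move=> _ [_ mm] _.
have [e' [e'0 e'e he']] := exists_small_inverse c e0.
have ce' := he' _ e'0 (lexx _).
have := mm e' e'0 ltac:(lra).
rewrite !(h (u + e')) ?(h (u - e')); try lra.
by clear -nm; lia.
Qed.

Lemma yreg_no_point p b x v n : cpf p -> Dgm p ((x, v%:E), n) ->
  x < b -> yreg p b v -> False.
Proof.
move=> pP [/= [->]|/= [uv [m [[_ mm] nm]]]] xb.
  by move=> [e [e0 h _]]; lra.
move=> /(yregE pP)[e [e0 uec h]].
pose e' := Num.min e (b - x).
have e'0 : 0 < e' by rewrite /e' !lt_min e0; lra.
have e'e : e' <= e by rewrite /e' ge_min lexx.
have e'v : e' <= b - x by rewrite /e' !ge_min lexx orbT.
have := mm e' e'0 ltac:(lra).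
rewrite !(h _ (v + e')) ?(h _ (v - e')); try lra.
by clear -nm; lia.
Qed.

End RankFunctions.

(** * Counting the cornerpoints in a box *)

Section Counting.
Context {R : realType}.
Implicit Types (p q : R -> \bar R -> int) (a b c d e u v x y : R).
Implicit Types (k : R * \bar R) (z : R * \bar R * nat).

Definition inbox a b c d k : Prop :=
  [/\ a < k.1, k.1 < b, (c%:E < k.2)%E & (k.2 < d%:E)%E].

(** The cardinality is an integer so that it can be compared with a mass, a combination of values of
    [p]. *)
Definition enumerates (A : set (R * \bar R * nat)) (n : int) : Prop :=
  exists s, [/\ uniq s, (size s)%:Z = n & forall z, z \in s <-> A z].

Lemma enumeratesU (A B C : set (R * \bar R * nat)) (m n : int) :
  enumerates A m -> enumerates B n -> (forall z, A z -> B z -> False) ->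
  (forall z, C z <-> A z \/ B z) -> enumerates C (m + n).
Proof.
move=> [s [us ss sA]] [t [ut st tB]] AB CAB; exists (s ++ t); split.
- rewrite cat_uniq us ut /= andbT; apply/negP => /hasP[z /tB Bz /sA Az].
  exact: AB Az Bz.
- by rewrite size_cat PoszD ss st.
- move=> z; rewrite mem_cat; split.
    by move=> /orP[/sA h|/tB h]; apply/CAB; [left|right].
  by move=> /CAB[/sA -> //|/tB ->]; rewrite orbT.
Qed.

Lemma enumerates_point p k (m : int) : 0 <= m -> (k.1%:E < k.2)%E ->
  mult p k.1 k.2 m -> enumerates (fun z => Dgm p z /\ z.1 = k) m.
Proof.
move=> m0 kk km; exists [seq (k, i) | i <- iota 0 `|m|%N]; split.
- by rewrite map_inj_uniq ?iota_uniq // => i j [].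
- by rewrite size_map size_iota; lia.
- move=> z; split.
    move=> /mapP[i]; rewrite mem_iota add0n => im ->; split => //; right.
    by split => //; exists m; split => //=; lia.
  move: z => [k' n] /= [D E]; move: D; rewrite {}E => -[/= kd|/= [_ [m' [km' nm]]]].
    by move: kk; rewrite kd ltxx.
  apply/mapP; exists n => //; rewrite mem_iota add0n.
  by rewrite (mult_uniq km' km) in nm; lia.
Qed.

Lemma enumerates_iff (A B : set (R * \bar R * nat)) (m : int) :
  (forall z, A z <-> B z) -> enumerates A m -> enumerates B m.
Proof.
by move=> AB [s [us ss sA]]; exists s; split => // z; split => [/sA/AB//|/AB/sA].
Qed.

(** [p] is constant on the four quadrants around [(u, v)], so every small square there has the mass
    of the whole box, which is thus the multiplicity. Any other point of the box lies on a regular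
    line. *)
Lemma box_count_atom p a b c d u v : cpf p ->
  a < u -> u < b -> b < c -> c < v -> v < d ->
  (forall x, a <= x -> x < u -> p x c%:E = p a c%:E) ->
  (forall x, u < x -> x <= b -> p x c%:E = p b c%:E) ->
  (forall y, c <= y -> y < v -> p b y%:E = p b c%:E) ->
  (forall y, v < y -> y <= d -> p b y%:E = p b d%:E) ->
  enumerates (fun z => Dgm p z /\ inbox a b c d z.1) (bmass p a b c d).
Proof.
move=> pP au ub bc cv vd hx1 hx2 hy1 hy2.
have Q1 x y : a <= x -> x < u -> c <= y -> p x y%:E = p a y%:E.
  move=> ax xu cy; apply/esym/(cpf_eqx pP ax _ cy); last exact/esym/hx1.
  exact: lt_trans xu (lt_trans ub bc).
have Q2 x y : u < x -> x <= b -> c <= y -> p x y%:E = p b y%:E.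
  by move=> ux xb cy; apply/(cpf_eqx pP xb bc cy)/hx2.
have Q3 x y : x <= b -> c <= y -> y < v -> p x y%:E = p x c%:E.
  by move=> xb cy yv; apply/esym/(cpf_eqy pP xb bc cy)/esym/hy1.
have Q4 x y : x <= b -> v < y -> y <= d -> p x y%:E = p x d%:E.
  move=> xb vy yd; apply/(cpf_eqy pP xb _ yd)/hy2 => //.
  exact: lt_trans bc (lt_trans cv vy).
clear hx1 hx2 hy1 hy2.
have uv : mult p u v%:E (bmass p a b c d).
  have [e1 [e10 h1 h2]] := exists_margin au ub.
  have [e2 [e20 h3 h4]] := exists_margin cv vd.
  have e0 : 0 < Num.min e1 e2 by rewrite lt_min e10.
  have l1 : Num.min e1 e2 <= e1 by rewrite ge_min lexx.
  have l2 : Num.min e1 e2 <= e2 by rewrite ge_min lexx orbT.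
  apply: (mult_finI pP e0); first lra.
  move=> e e_gt0 ee0; rewrite /bmass.
  have ue : u < u + e by lra.
  have eu : u - e < u by lra.
  have uea : a <= u - e by lra.
  have ueb : u + e <= b by lra.
  have ve : v < v + e by lra.
  have ev : v - e < v by lra.
  have cve : c <= v - e by lra.
  have ved : v + e <= d by lra.
  have cve' := le_trans cve (le_trans (ltW ev) (ltW ve)).
  have ab := le_trans uea (le_trans (ltW eu) (ltW ub)).
  by rewrite !(Q2 (u + e)) // !(Q1 (u - e)) // !(Q3 _ (v - e)) // !(Q4 _ (v + e)).
apply: (@enumerates_iff (fun z => Dgm p z /\ z.1 = (u, v%:E))); last first.
  apply: enumerates_point => //=.
    by apply: bmass_ge0 => //; lra.
  by rewrite lte_fin; lra.
move=> z; split.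
  by move=> [D E]; split => //; rewrite E; split => //=; rewrite lte_fin.
move: z => [[x [y||]] i] [D] [] //=; rewrite ?lte_fin => ax xb cy yd.
split => //; congr (_, _%:E).
  have cyE : (c%:E < y%:E)%E by rewrite lte_fin.
  apply: contrapT => xu; apply: (xreg_no_point pP D cyE) => /=.
  move: xu => /eqP; rewrite neq_lt => /orP[xu|ux].
    have [e [e_gt0 h1 h2]] := exists_margin ax xu.
    by apply: (xregI pP e_gt0); [lra|rewrite !Q1 //; lra].
  have [e [e_gt0 h1 h2]] := exists_margin ux xb.
  by apply: (xregI pP e_gt0); [lra|rewrite !Q2 //; lra].
apply: contrapT => yv; apply: (yreg_no_point pP D xb).
move: yv => /eqP; rewrite neq_lt => /orP[yv|vy].
  have [e [e_gt0 h1 h2]] := exists_margin cy yv.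
  by apply: (yregI pP e_gt0); [lra|rewrite !Q3 //; lra].
have [e [e_gt0 h1 h2]] := exists_margin vy yd.
by apply: (yregI pP e_gt0); [lra|rewrite !Q4 //; lra].
Qed.

(** No cornerpoint of the box lies on the regular line at [m], so the two halves share out the
    points, and the masses add up. *)
Lemma box_count_cutx p a m b c d : cpf p -> a < m -> m < b -> xreg p c m ->
  enumerates (fun z => Dgm p z /\ inbox a m c d z.1) (bmass p a m c d) ->
  enumerates (fun z => Dgm p z /\ inbox m b c d z.1) (bmass p m b c d) ->
  enumerates (fun z => Dgm p z /\ inbox a b c d z.1) (bmass p a b c d).
Proof.
move=> pP am mb xm e1 e2.
have -> : bmass p a b c d = bmass p a m c d + bmass p m b c d.
  by rewrite /bmass; lra.
apply: enumeratesU e1 e2 _ _ => z.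
  move=> [_ [_ zm _ _]] [_ [mz _ _ _]].
  by have := lt_trans zm mz; rewrite ltxx.
split; last first.
  move=> [[D [h1 h2 h3 h4]]|[D [h1 h2 h3 h4]]]; split => //; split => //.
    exact: lt_trans h2 mb.
  exact: lt_trans am h1.
move=> [D [h1 h2 h3 h4]].
have [zm|mz|zm] := ltgtP z.1.1 m; [by left|by right|].
by exfalso; apply: (xreg_no_point pP D h3); rewrite zm.
Qed.

Lemma box_count_cuty p a b c m d : cpf p -> c < m -> m < d -> yreg p b m ->
  enumerates (fun z => Dgm p z /\ inbox a b c m z.1) (bmass p a b c m) ->
  enumerates (fun z => Dgm p z /\ inbox a b m d z.1) (bmass p a b m d) ->
  enumerates (fun z => Dgm p z /\ inbox a b c d z.1) (bmass p a b c d).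
Proof.
move=> pP cm md ym e1 e2.
have -> : bmass p a b c d = bmass p a b c m + bmass p a b m d.
  by rewrite /bmass; lra.
apply: enumeratesU e1 e2 _ _ => z.
  move=> [_ [_ _ _ zm]] [_ [_ _ mz _]].
  by have := lt_trans zm mz; rewrite ltxx.
split; last first.
  move=> [[D [h1 h2 h3 h4]]|[D [h1 h2 h3 h4]]]; split => //; split => //.
    by apply: lt_trans h4 _; rewrite lte_fin.
  by apply: lt_trans h3; rewrite lte_fin.
move=> [D [h1 h2 h3 h4]].
have [zm|mz|zm] := ltgtP z.1.2 m%:E; [by left|by right|].
exfalso; move: z D h1 h2 h3 h4 zm => [[x y] i] /= D h1 h2 _ _ yE.
by rewrite yE in D; exact: yreg_no_point pP D h2 ym.
Qed.

(* Cutting at regular abscissae and ordinates splits both the mass and the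
   diagram, and lowers the number of jumps; a box that cannot be cut has a
   single possible cornerpoint, whose multiplicity is the mass. *)
Lemma box_count p a b c d : cpf p -> a < b -> b < c -> c < d ->
  xreg p c a -> xreg p c b -> yreg p b c -> yreg p b d ->
  enumerates (fun z => Dgm p z /\ inbox a b c d z.1) (bmass p a b c d).
Proof.
move=> pP.
(* The induction is on the jumps along the bottom side plus those along the right side. *)
have [n] : exists n : nat,
    (p b c%:E - p a c%:E) + (p b c%:E - p b d%:E) < n%:Z.
  exists (absz ((p b c%:E - p a c%:E) + (p b c%:E - p b d%:E))).+1.
  by lia.
elim: n a b c d => [|n IHn] a b c d J ab bc cd xa xb yc yd.
  have [h1 _ _] := cpfE pP (ltW ab) bc (lexx c).
  have [_ h2 _] := cpfE pP (lexx b) bc (ltW cd).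
  by lra.
move: J; rewrite intS => J.
have fx := cpf_monox (a := a) pP bc.
have [|||[m [e [am mb e0 fme [fam fmb]]]]] := atom_or_cut ab fx.
- by have [e [e0 _ h]] := xa; exists e => // x ? ?; apply: h => //; lra.
- by have [e [e0 _ h]] := xb; exists e => // x ? ?; apply: h => //; lra.
- have fy := cpf_monoy (d := d) pP bc.
  move=> [u [au ub hx1 hx2]].
  have [|||[m [e [cm md e0 /oppr_inj fme]]]] := atom_or_cut cd fy.
  + have [e [e0 _ h]] := yc; exists e => // x ? ?.
    by congr (- _); apply: h => //; lra.
  + have [e [e0 _ h]] := yd; exists e => // x ? ?.
    by congr (- _); apply: h => //; lra.
  + move=> [v [cv vd hy1 hy2]].
    apply: (box_count_atom pP au ub bc cv vd hx1 hx2) => y h1 h2.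
      exact/oppr_inj/hy1.
    exact/oppr_inj/hy2.
  + rewrite !ltrN2 -fme => -[fcm fmd]; clear fx fy hx1 hx2 au ub u.
    have bme : b < m - e by lra.
    have cm' : c < m by lra.
    have md' : m < d by lra.
    have bm : b < m by lra.
    have ym : yreg p b m by apply: (yregI pP e0).
    have pbm : p b m%:E = p b (m - e)%:E.
      have [_ K _] := @cpfE _ p b b (m - e) m pP (lexx _) bme ltac:(lra).
      have [_ L _] := @cpfE _ p b b m (m + e) pP (lexx _) bm ltac:(lra).
      by apply/le_anti; rewrite K fme L.
    have fcm' : p b m%:E + 1 <= p b c%:E by rewrite lezD1 pbm.
    have fmd' : p b d%:E + 1 <= p b m%:E by rewrite lezD1 pbm.
    (* Condition (2) bounds the jumps along the new bottom side, at ordinate [m], by those at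
       [c]. *)
    have [_ _ h] := cpfE pP (ltW ab) bc (ltW cm').
    apply: (box_count_cuty pP cm' md' ym); apply: IHn => //.
    * by clear -J fcm' fmd'; lra.
    * by clear -J fcm' fmd' h; lra.
    * exact: xreg_le (ltW cm') xa.
    * exact: xreg_le (ltW cm') xb.
- clear fx.
  have am' : a < m by lra.
  have mb' : m < b by lra.
  have mec : m + e < c by lra.
  have mc : m < c by lra.
  have xm : xreg p c m by apply: (xregI pP e0).
  have pbm : p m c%:E = p (m - e) c%:E.
    have [K _ _] := @cpfE _ p (m - e) m c c pP ltac:(lra) mc (lexx _).
    have [L _ _] := @cpfE _ p m (m + e) c c pP ltac:(lra) mec (lexx _).
    by apply/le_anti; rewrite K fme L.
  have fcm' : p a c%:E + 1 <= p m c%:E by rewrite lezD1 pbm.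
  have fmd' : p m c%:E + 1 <= p b c%:E by rewrite lezD1 pbm fme.
  have [_ _ h] := cpfE pP (ltW mb') bc (ltW cd).
  apply: (box_count_cutx pP am' mb' xm); apply: IHn => //.
  + by clear -J fcm' fmd' h; lra.
  + exact: yreg_le (ltW mb') yc.
  + exact: yreg_le (ltW mb') yd.
  + by clear -J fcm' fmd' h; lra.
Qed.

End Counting.

(** * Nested boxes, points at infinity, and local finiteness *)

Section LocalCounting.
Context {R : realType}.
Implicit Types (p q : R -> \bar R -> int) (a b c d e u v x y h l r : R).
Implicit Types (k : R * \bar R) (z : R * \bar R * nat).

(** Every gap contains a regular line, so a box acquires regular sides by moving them slightly. This
    serves for a [q] whose jumps are not controlled. *)
Lemma box_count_between q a' a b b' c' c d d' : cpf q ->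
  a' < a -> a <= b -> b < b' -> b' < c' -> c' < c -> c <= d -> d < d' ->
  exists a1 b1 c1 d1, [/\ a' < a1 /\ a1 < a, b < b1 /\ b1 < b',
    c' < c1 /\ c1 < c, d < d1 /\ d1 < d' &
    enumerates (fun z => Dgm q z /\ inbox a1 b1 c1 d1 z.1)
      (bmass q a1 b1 c1 d1)].
Proof.
move=> qP aa ab bb bc cc cd dd.
have ac' : a < c' by lra.
have b'c : b' < c by lra.
have b'd : b' < d by lra.
(* Abscissae are taken regular at the low ordinate [c'] and ordinates regular at the large abscissa
   [b'], so that both properties pass to the final [c1 > c'] and [b1 < b']. *)
have [a1 [h1 h2 xa]] := xreg_exists qP aa ac'.
have [b1 [h3 h4 xb]] := xreg_exists qP bb bc.
have [c1 [h5 h6 yc]] := yreg_exists qP bc cc.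
have [d1 [h7 h8 yd]] := yreg_exists qP b'd dd.
exists a1, b1, c1, d1; split => //; apply: box_count => //; try lra.
- exact: xreg_le (ltW h5) xa.
- exact: xreg_le (ltW h5) xb.
- exact: yreg_le (ltW h4) yc.
- exact: yreg_le (ltW h4) yd.
Qed.

(** Beyond [c] the ordinate no longer matters, so the jump across [u] is the multiplicity of
    [(u, +oo)]. *)
Lemma strip_count_atom p a b c u : cpf p -> a < u -> u < b -> b < c ->
  (forall x, a <= x -> x < u -> p x c%:E = p a c%:E) ->
  (forall x, u < x -> x <= b -> p x c%:E = p b c%:E) ->
  (forall y, c <= y -> p b y%:E = p b c%:E) ->
  enumerates (fun z => Dgm p z /\ [/\ a < z.1.1, z.1.1 < b & z.1.2 = +oo%E])
    (p b c%:E - p a c%:E).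
Proof.
move=> pP au ub bc hx1 hx2 pb.
have uoo : mult p u +oo%E (p b c%:E - p a c%:E).
  have [e1 [e10 h1 h2]] := exists_margin au ub.
  (* For [e <= e2] the ordinate [e^-1] of the defining expression is at least [c]. *)
  have [e2 [e20 e21 h]] := exists_small_inverse c e10.
  have st x e : x <= b -> 0 < e -> e <= e2 -> p x (e^-1)%:E = p x c%:E.
    move=> xb e0 ee2; have ce := h e e0 ee2.
    exact/esym/(cpf_eqy pP xb bc ce)/esym/pb.
  apply: (mult_infI pP e20) => e e0 ee2.
    by have := h e e0 ee2; lra.
  by rewrite !st ?(hx1 (u - e)) ?(hx2 (u + e)) //; lra.
apply: (@enumerates_iff _ (fun z => Dgm p z /\ z.1 = (u, +oo%E))); last first.
  apply: enumerates_point; rewrite //= ?ltry // subr_ge0.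
  by have [] := @cpfE _ p a b c c pP ltac:(lra) bc (lexx _).
move=> z; split; first by move=> [D E]; split => //; rewrite E.
move: z => [[x y] i] [D] /= [ax xb yE]; split => //; congr (_, _) => //.
have cy : (c%:E < ((x, y), i).1.2)%E by rewrite /= yE ltry.
apply: contrapT => xu; apply: (xreg_no_point pP D cy) => /=.
move: xu => /eqP; rewrite neq_lt => /orP[xu|ux].
  have [e [e_gt0 h1 h2]] := exists_margin ax xu.
  by apply: (xregI pP e_gt0); [lra|rewrite !hx1 //; lra].
have [e [e_gt0 h1 h2]] := exists_margin ux xb.
by apply: (xregI pP e_gt0); [lra|rewrite !hx2 //; lra].
Qed.

Lemma strip_count_cut p a m b c : cpf p -> a < m -> m < b -> xreg p c m ->
  enumerates (fun z => Dgm p z /\ [/\ a < z.1.1, z.1.1 < m & z.1.2 = +oo%E])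
    (p m c%:E - p a c%:E) ->
  enumerates (fun z => Dgm p z /\ [/\ m < z.1.1, z.1.1 < b & z.1.2 = +oo%E])
    (p b c%:E - p m c%:E) ->
  enumerates (fun z => Dgm p z /\ [/\ a < z.1.1, z.1.1 < b & z.1.2 = +oo%E])
    (p b c%:E - p a c%:E).
Proof.
move=> pP am mb xm e1 e2.
have -> : p b c%:E - p a c%:E = (p m c%:E - p a c%:E) + (p b c%:E - p m c%:E).
  by lra.
apply: enumeratesU e1 e2 _ _ => z.
  by move=> [_ [_ zm _]] [_ [mz _ _]]; have := lt_trans zm mz; rewrite ltxx.
split; last first.
  move=> [[D [h1 h2 h3]]|[D [h1 h2 h3]]]; split => //; split => //.
    exact: lt_trans h2 mb.
  exact: lt_trans am h1.
move=> [D [h1 h2 h3]].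
have [zm|mz|zm] := ltgtP z.1.1 m; [by left|by right|].
exfalso; apply: (@xreg_no_point _ p c z pP D); last by rewrite zm.
by rewrite h3 ltry.
Qed.

(** The induction of [box_count], with cuts at abscissae only. *)
Lemma strip_count p a b c : cpf p -> a < b -> b < c ->
  xreg p c a -> xreg p c b -> (forall y, c <= y -> p b y%:E = p b c%:E) ->
  enumerates (fun z => Dgm p z /\ [/\ a < z.1.1, z.1.1 < b & z.1.2 = +oo%E])
    (p b c%:E - p a c%:E).
Proof.
move=> pP.
have [n] : exists n : nat, p b c%:E - p a c%:E < n%:Z.
  by exists (absz (p b c%:E - p a c%:E)).+1; lia.
elim: n a b => [|n IHn] a b J ab bc xa xb pb.
  by have [h1 _ _] := cpfE pP (ltW ab) bc (lexx c); lra.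
move: J; rewrite intS => J.
have fx := cpf_monox (a := a) pP bc.
have [|||[m [e [am mb e0 fme [fam fmb]]]]] := atom_or_cut ab fx.
- by have [e [e0 _ h]] := xa; exists e => // x ? ?; apply: h => //; lra.
- by have [e [e0 _ h]] := xb; exists e => // x ? ?; apply: h => //; lra.
- by move=> [u [au ub hx1 hx2]]; exact: (strip_count_atom pP au ub bc hx1 hx2).
clear fx.
have am' : a < m by lra.
have mb' : m < b by lra.
have mec : m + e < c by lra.
have mc : m < c by lra.
have xm : xreg p c m by apply: (xregI pP e0).
have pbm : p m c%:E = p (m - e) c%:E.
  have [K _ _] := @cpfE _ p (m - e) m c c pP ltac:(lra) mc (lexx _).
  have [L _ _] := @cpfE _ p m (m + e) c c pP ltac:(lra) mec (lexx _).
  by apply/le_anti; rewrite K fme L.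
have fcm' : p a c%:E + 1 <= p m c%:E by rewrite lezD1 pbm.
have fmd' : p m c%:E + 1 <= p b c%:E by rewrite lezD1 pbm fme.
apply: (strip_count_cut pP am' mb' xm); apply: IHn => //.
- by clear -J fcm' fmd'; lra.
- by move=> y cy; apply/esym/(cpf_eqy pP (ltW mb') bc cy)/esym/pb.
- by clear -J fcm' fmd'; lra.
Qed.

Lemma strip_count_between q a' a b b' c : cpf q ->
  a' < a -> a <= b -> b < b' -> b' < c ->
  (forall y, c <= y -> q b' y%:E = q b' c%:E) ->
  exists a1 b1, [/\ a' < a1 /\ a1 < a, b < b1 /\ b1 < b' &
    enumerates (fun z => Dgm q z /\ [/\ a1 < z.1.1, z.1.1 < b1 & z.1.2 = +oo%E])
      (q b1 c%:E - q a1 c%:E)].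
Proof.
move=> qP aa ab bb bc st.
have ac : a < c by lra.
have [a1 [h1 h2 xa]] := xreg_exists qP aa ac.
have [b1 [h3 h4 xb]] := xreg_exists qP bb bc.
exists a1, b1; split => //; apply: strip_count => //; try lra.
by move=> y cy; apply/esym/(cpf_eqy qP (ltW h4) bc cy)/esym/st.
Qed.

(** This is [pdist] at most [r], except that a second coordinate [-oo] is close to nothing. *)
Definition close (r : R) (k k' : R * \bar R) : Prop :=
  `|k.1 - k'.1| <= r /\
  match k.2, k'.2 with
  | EFin v, EFin v' => `|v - v'| <= r
  | EPInf, EPInf => True
  | _, _ => False
  end.

Lemma close_sym r k k' : close r k k' -> close r k' k.
Proof.
rewrite /close distrC; case: k.2 k'.2 => [v||] [v'||] //.
by rewrite (distrC v v').
Qed.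

Lemma close_le r r' k k' : r <= r' -> close r k k' -> close r' k k'.
Proof.
move=> rr' [h]; rewrite /close; case: k.2 k'.2 => [v||] [v'||] // h';
by split => //; lra.
Qed.

Lemma close_trans r r' k1 k2 k3 :
  close r k1 k2 -> close r' k2 k3 -> close (r + r') k1 k3.
Proof.
move=> [h1 h2] [h1' h2']; split.
  by apply: le_trans (ler_distD k2.1 _ _) _; lra.
case: k1.2 k2.2 k3.2 h2 h2' => [v1||] [v2||] [v3||] //= h h'.
by apply: le_trans (ler_distD v2 _ _) _; lra.
Qed.

Lemma close_inf r k k' :
  (forall e, 0 < e -> close (r + e) k k') -> close r k k'.
Proof.
move=> h; split.
  by apply/ler_addgt0Pr => e /h[].
move: k k' h => [x [v||]] [x' [v'||]] //= h; try by have [] := h 1 ltr01.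
by apply/ler_addgt0Pr => e /h[].
Qed.

(** The ball around [k] stays strictly above the diagonal, so it fits in a box, or in a strip when
    [k] is at infinity, where the counting lemmas apply. *)
Lemma diagram_finite_near p k r : cpf p -> 0 < r ->
  ((k.1 + r + r)%:E < k.2)%E ->
  exists s : seq (R * \bar R * nat),
    forall z, Dgm p z -> close r k z.1 -> z \in s.
Proof.
move: k => [u [v||]] pP r0 //=; rewrite ?lte_fin => far.
(* The margin [g] is a third of the gap between [u + r] and [v - r], so the enlarged box still
   avoids the diagonal. *)
- have [g [g0 h1 h2]] : exists g, [/\ 0 < g, u + r + g < v - r - g & u + r < v - r].
    by exists ((v - r - (u + r)) / 3); split; lra.
  have [||||||| a [b [c [d [[? ?] [? ?] [? ?] [? ?] [s [_ _ sP]]]]]]] :=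
    @box_count_between p (u - r - 1) (u - r) (u + r) (u + r + g)
      (v - r - g) (v - r) (v + r) (v + r + 1) pP; try lra.
  exists s => -[[x [y||]] i] D [] //=.
  rewrite !ler_norml => /andP[? ?] /andP[? ?]; apply/sP; split => //.
  by split; rewrite /= ?lte_fin; lra.
- have [m pm] := pP.1.
  have [||c [cu cP]] := @stabilizes_at_infinity _
    (fun y => p (u + r + 1) y%:E) (u + r + 2) m.
  + by move=> y uy; apply: pm; rewrite lte_fin; lra.
  + move=> x y ux xy.
    have urx : u + r + 1 < x by lra.
    by have [] := cpfE pP (lexx (u + r + 1)) urx xy.
  have [|||| a [b [[? ?] [? ?] [s [_ _ sP]]]]] :=
    @strip_count_between p (u - r - 1) (u - r) (u + r) (u + r + 1) c pP _ _ _ _ cP;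
    try lra.
  exists s => -[[x [y||]] i] D [] //=.
  rewrite !ler_norml => /andP[? ?] _; apply/sP; split => //.
  by split => //=; lra.
Qed.

End LocalCounting.

(** * Stability of the local count under interleaving *)

Section LocalStability.
Context {R : realType}.
Implicit Types (p q : R -> \bar R -> int) (a b c d e u v x y h l r : R).
Implicit Types (k : R * \bar R) (z : R * \bar R * nat).

Definition interleaved h p q : Prop := forall u v, u < v ->
  p (u - h) (v + h)%:E <= q u v%:E /\ q (u - h) (v + h)%:E <= p u v%:E.

(** Used in both coordinates, it says that two points lie in the same quadrant around [(u, v)]. *)
Definition same_side r u x x' : Prop :=
  (u - r <= x /\ x < u) /\ (u - r <= x' /\ x' < u) \/
  (u < x /\ x <= u + r) /\ (u < x' /\ x' <= u + r).

Lemma same_side_shift r u x h : 0 < h ->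
  (u - r + h <= x /\ x < u - h) \/ (u + h < x /\ x <= u + r - h) ->
  same_side r u (x - h) x /\ same_side r u (x + h) x.
Proof. by move=> h0 [[? ?]|[? ?]]; split; [left|left|right|right]; lra. Qed.

Lemma eqx_any p x x' c y : cpf p -> x < c -> x' < c -> c <= y ->
  p x c%:E = p x' c%:E -> p x y%:E = p x' y%:E.
Proof.
move=> pP xc x'c cy E; have [xx'|x'x] := lerP x x'.
  exact: (cpf_eqx pP xx' x'c cy).
exact/esym/(cpf_eqx pP (ltW x'x) xc cy).
Qed.

Lemma eqy_any p x b y y' : cpf p -> x <= b -> b < y -> b < y' ->
  p b y%:E = p b y'%:E -> p x y%:E = p x y'%:E.
Proof.
move=> pP xb bY bY' E; have [yy'|y'y] := lerP y y'.
  exact: (cpf_eqy pP xb bY yy').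
exact/esym/(cpf_eqy pP xb bY' (ltW y'y)).
Qed.

(** Pick [u < b < c < v]. Jumps at ordinate [c] do not accumulate at [u], nor those at abscissa [b]
    at [v]; [eqx_any] and [eqy_any] spread the constancy over the quadrants. *)
Lemma constant_on_quadrants p u v rho : cpf p -> u < v -> 0 < rho ->
  exists r, [/\ 0 < r, r <= rho, u + r < v - r &
    forall x x' y y', same_side r u x x' -> same_side r v y y' ->
      p x y%:E = p x' y'%:E].
Proof.
move=> pP uv rho0.
have [b [c [ub bc cv]]] : exists b c, [/\ u < b, b < c & c < v].
  by exists ((u + u + v) / 3), ((u + v + v) / 3); split; lra.
have u1 : u - 1 < u by lra.
have v1 : v < v + 1 by lra.
have [r1 [r10 _ h1 L1 R1]] :=
  constant_on_both_sides u1 ub (cpf_monox (a := u - 1) pP bc).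
have [r2 [r20 h2 _ L2 R2]] :=
  constant_on_both_sides cv v1 (cpf_monoy (d := v + 1) pP bc).
pose r := Num.min (Num.min r1 r2) rho.
have rr1 : r <= r1 by rewrite !ge_min lexx.
have rr2 : r <= r2 by rewrite !ge_min lexx orbT.
exists r; split.
- by rewrite !lt_min r10 r20.
- by rewrite ge_min lexx orbT.
- by lra.
move=> x x' y y' sx sy.
have xb : x <= b by case: sx => -[[? ?] [? ?]]; lra.
have x'c : x' < c by case: sx => -[[? ?] [? ?]]; lra.
have cy : c <= y by case: sy => -[[? ?] [? ?]]; lra.
have cy' : c <= y' by case: sy => -[[? ?] [? ?]]; lra.
have -> : p x y%:E = p x y'%:E.
  apply: (eqy_any pP xb); try lra; apply: oppr_inj.
  by case: sy => -[[? ?] [? ?]]; [apply: L2|apply: R2]; lra.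
apply: (eqx_any pP _ x'c cy'); first lra.
by case: sx => -[[? ?] [? ?]]; [apply: L1|apply: R1]; lra.
Qed.

(** [q x y] lies between [p (x - h) (y + h)] and [p (x + h) (y - h)], and both shifted points remain
    in the quadrant of [(x, y)], where [p] is constant. *)
Lemma interleaved_agree p q r h u v x y : interleaved h p q -> 0 < h ->
  u + r < v - r ->
  (forall x x' y y', same_side r u x x' -> same_side r v y y' ->
      p x y%:E = p x' y'%:E) ->
  (u - r + h <= x /\ x < u - h) \/ (u + h < x /\ x <= u + r - h) ->
  (v - r + h <= y /\ y < v - h) \/ (v + h < y /\ y <= v + r - h) ->
  q x y%:E = p x y%:E.
Proof.
move=> pq h0 uv Q sx sy.
have [x1 x2] := same_side_shift h0 sx.
have [y1 y2] := same_side_shift h0 sy.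
have xx : same_side r u x x by case: x1 => -[_ [? ?]]; [left|right].
have yy : same_side r v y y by case: y1 => -[_ [? ?]]; [left|right].
have xy : x < y by case: xx => -[_ [? ?]]; case: yy => -[_ [? ?]]; lra.
have xhyh : x + h < y - h.
  by case: sx => -[? ?]; case: sy => -[? ?]; lra.
have := (pq x y xy).1; have := (pq _ _ xhyh).2.
rewrite addrK subrK (Q _ _ _ _ x2 y1) (Q _ _ _ _ x1 y2) => h1 h2.
by apply/le_anti; rewrite h1 h2.
Qed.

(** Two radii occur because sides regular for [q] are only found in a gap, here between [l] and
    [l']. The bounds [h <= l] and [l' <= r - h] make [q] agree with [p] at the corners of the
    resulting box. *)
Definition locally_counted p k r (m : nat) : Prop :=
  forall q h l l', cpf q -> interleaved h p q ->
    0 < h -> h <= l -> l < l' -> l' <= r - h ->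
  exists s : seq (R * \bar R * nat), [/\ uniq s, size s = m,
    forall z, z \in s -> Dgm q z /\ close l' k z.1 &
    forall z, Dgm q z -> close l k z.1 -> z \in s].

Lemma local_count_fin p u v rho : cpf p -> u < v -> 0 < rho ->
  exists r (m : nat), [/\ 0 < r, r <= rho, mult p u v%:E m%:Z &
    locally_counted p (u, v%:E) r m].
Proof.
move=> pP uv rho0.
have [r [r0 rrho urv Q]] := constant_on_quadrants pP uv rho0.
have sL w e : 0 < e -> e <= r -> same_side r w (w - e) (w - r).
  by move=> ? ?; left; lra.
have sR w e : 0 < e -> e <= r -> same_side r w (w + e) (w + r).
  by move=> ? ?; right; lra.
pose m := bmass p (u - r) (u + r) (v - r) (v + r).
have m0 : 0 <= m by apply: bmass_ge0 => //; lra.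
have QM e1 e2 e3 e4 : 0 < e1 -> e1 <= r -> 0 < e2 -> e2 <= r ->
    0 < e3 -> e3 <= r -> 0 < e4 -> e4 <= r ->
    bmass p (u - e1) (u + e2) (v - e3) (v + e4) = m.
  move=> *; rewrite /m /bmass.
  rewrite (Q _ _ _ _ (sR u e2 _ _) (sL v e3 _ _)) //.
  rewrite (Q _ _ _ _ (sL u e1 _ _) (sL v e3 _ _)) //.
  rewrite (Q _ _ _ _ (sR u e2 _ _) (sR v e4 _ _)) //.
  by rewrite (Q _ _ _ _ (sL u e1 _ _) (sR v e4 _ _)).
exists r, (absz m); split => //.
  rewrite gez0_abs //; apply: (mult_finI pP r0) => // e e0 er.
  exact: QM.
move=> q h l l' qP pq h0 hl ll' l'r.
have [|||||||a [b [c [d [[a1 a2] [b1 b2] [c1 c2] [d1 d2] [s [us ss sP]]]]]]] :=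
  @box_count_between _ q (u - l') (u - l) (u + l) (u + l') (v - l') (v - l)
     (v + l) (v + l') qP; try lra.
exists s; split => //.
- have H x y sx sy := @interleaved_agree p q r h u v x y pq h0 urv Q sx sy.
  suff : (size s)%:Z = m by move=> <-.
  rewrite ss /bmass.
  rewrite !H; try by [left; lra|right; lra].
  have := @QM (u - a) (b - u) (v - c) (d - v).
  have -> : u - (u - a) = a by lra.
  have -> : u + (b - u) = b by lra.
  have -> : v - (v - c) = c by lra.
  have -> : v + (d - v) = d by lra.
  by move=> <- //; lra.
- move=> [[x [y||]] i] /sP[D [/= ? ?]] //; rewrite !lte_fin => ? ?.
  by split => //; split; rewrite /= ler_norml; apply/andP; split; lra.
- move=> [[x [y||]] i] D [] //=.
  rewrite !ler_norml => /andP[? ?] /andP[? ?]; apply/sP; split => //.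
  by split; rewrite /= ?lte_fin; lra.
Qed.

(** At infinity the quadrants reduce to two half-strips above an ordinate where [p] has stabilised,
    and the mass becomes an increment in the abscissa. *)
Lemma local_count_inf p u rho : cpf p -> 0 < rho ->
  exists r (m : nat), [/\ 0 < r, r <= rho, mult p u +oo%E m%:Z &
    locally_counted p (u, +oo%E) r m].
Proof.
move=> pP rho0.
have [n pn] := pP.1.
have [||c [uc cP]] := @stabilizes_at_infinity _
  (fun y => p (u + 1) y%:E) (u + 2) n.
- by move=> y uy; apply: pn; rewrite lte_fin; lra.
- move=> x y ux xy; have u1x : u + 1 < x by lra.
  by have [] := cpfE pP (lexx (u + 1)) u1x xy.
have u1 : u - 1 < u by lra.
have u2 : u < u + 1 by lra.
have u1c : u + 1 < c by lra.
have [r1 [r10 _ h1 L1 R1]] :=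
  constant_on_both_sides u1 u2 (cpf_monox (a := u - 1) pP u1c).
pose r := Num.min r1 rho.
have rr1 : r <= r1 by rewrite ge_min lexx.
have r0 : 0 < r by rewrite lt_min r10 rho0.
have st x y : x <= u + 1 -> c <= y -> p x y%:E = p x c%:E.
  by move=> xu cy; apply/esym/(cpf_eqy pP xu u1c cy)/esym/cP.
have Lr x y : u - r <= x -> x < u -> c <= y -> p x y%:E = p (u - r) c%:E.
  by move=> ? ? ?; rewrite st //; [apply: L1; lra|lra].
have Rr x y : u < x -> x <= u + r -> c <= y -> p x y%:E = p (u + r) c%:E.
  by move=> ? ? ?; rewrite st //; [apply: R1; lra|lra].
clear L1 R1 st cP.
pose m := p (u + r) c%:E - p (u - r) c%:E.
have m0 : 0 <= m.
  rewrite subr_ge0.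
  by have [] := @cpfE _ p (u - r) (u + r) c c pP ltac:(lra) ltac:(lra) (lexx _).
exists r, (absz m); split => //; first by rewrite ge_min lexx orbT.
  have [e0 [e00 e0r he]] := exists_small_inverse c r0.
  rewrite gez0_abs //; apply: (mult_infI pP e00) => e e_gt0 ee0.
    by have := he e e_gt0 ee0; lra.
  have ce := he e e_gt0 ee0.
  have ue : u < u + e by lra.
  have eu : u - e < u by lra.
  have uer : u + e <= u + r by lra.
  have reu : u - r <= u - e by lra.
  by rewrite (Rr _ _ ue uer ce) (Lr _ _ reu eu ce).
move=> q h l l' qP pq h0 hl ll' l'r.
(* Ordinates start at [c + h] so that lowering them by [h] does not go below [c]. *)
have H1 x y : u - r + h <= x -> x < u - h -> c + h <= y ->
    q x y%:E = p (u - r) c%:E.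
  move=> ? ? ?.
  have xy : x < y by lra.
  have xhyh : x + h < y - h by lra.
  have := (pq x y xy).1; have := (pq _ _ xhyh).2.
  rewrite addrK subrK !Lr; try lra.
have H2 x y : u + h < x -> x <= u + r - h -> c + h <= y ->
    q x y%:E = p (u + r) c%:E.
  move=> ? ? ?.
  have xy : x < y by lra.
  have xhyh : x + h < y - h by lra.
  have := (pq x y xy).1; have := (pq _ _ xhyh).2.
  rewrite addrK subrK !Rr; try lra.
have [|||||a [b [[a1 a2] [b1 b2] [s [us ss sP]]]]] :=
  @strip_count_between _ q (u - l') (u - l) (u + l) (u + l') (c + h) qP;
  try lra.
  by move=> y cy; rewrite !H2 //; lra.
exists s; split => //.
- suff : (size s)%:Z = m by move=> <-.
  by rewrite ss (H1 a) ?(H2 b) //; lra.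
- move=> [[x y] i] /sP[D [/= ? ? yE]].
  split => //; rewrite /close /= yE; split => //.
  by rewrite ler_norml; apply/andP; split; lra.
- move=> [[x [y||]] i] D [] //=.
  rewrite !ler_norml => /andP[? ?] _; apply/sP; split => //.
  by split => //=; lra.
Qed.

Lemma local_count p k rho : cpf p -> (k.1%:E < k.2)%E -> 0 < rho ->
  exists r (m : nat), [/\ 0 < r, r <= rho, mult p k.1 k.2 m%:Z &
    locally_counted p k r m].
Proof.
move: k => [u [v||]] pP //=.
  by rewrite lte_fin => uv; apply: local_count_fin.
by move=> _; apply: local_count_inf.
Qed.

End LocalStability.

(** * Closeness of points, and limits along ultrafilters *)

Section Matching.
Context {R : realType}.
Implicit Types (p : R -> \bar R -> int) (c e t r : R) (k : R * \bar R).
Local Notation elt := ((R * \bar R) * nat)%type.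

Lemma close_refl r k : 0 <= r -> k.2 != -oo%E -> close r k k.
Proof.
by move: k => [x [y||]] r0 //= _; rewrite /close /= !subrr normr0.
Qed.

Lemma close_eq k k' : (forall e, 0 < e -> close e k k') -> k = k'.
Proof.
move=> h.
have h0 : close 0 k k' by apply: close_inf => e e0; rewrite add0r; apply: h.
move: k k' h0 {h} => [x y] [x' y'] [/=]; rewrite normr_le0 subr_eq0 => /eqP ->.
case: y y' => [y||] [y'||] //.
by rewrite normr_le0 subr_eq0 => /eqP ->.
Qed.

(** Persistence above [2c]: by [far_close], a displacement of at most [c] does not reach the
    diagonal. *)
Definition far c k : Prop := ((k.1 + c + c)%:E < k.2)%E.

Lemma far_close c k k' : far c k -> close c k k' -> (k'.1%:E < k'.2)%E.
Proof.
move: k k' => [x [y||]] [x' [y'||]] //=; rewrite /far /close /= ?ltry //;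
  try by move=> _ [].
by rewrite !lte_fin !ler_norml => h [/andP[? ?] /andP[? ?]]; lra.
Qed.

Lemma Dgm_off p k n m : (k.1%:E < k.2)%E -> mult p k.1 k.2 m ->
  Dgm p (k, n) <-> n%:Z < m.
Proof.
move=> kk km; split; last by move=> nm; right; split => //; exists m.
move=> [/= kd|[_ [m' [/= km' nm']]]]; first by move: kk; rewrite kd ltxx.
by rewrite (mult_uniq km km').
Qed.

Lemma common_positive (T : eqType) (s : seq T) (P : T -> R -> Prop) :
  (forall x r r', r' <= r -> P x r -> P x r') ->
  (forall x, x \in s -> exists2 r, 0 < r & P x r) ->
  exists2 r, 0 < r & forall x, x \in s -> P x r.
Proof.
move=> Pm; elim: s => [|x s IHs] h; first by exists 1.
have [y ys|r r0 rP] := IHs; first by apply: h; rewrite inE ys orbT.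
have [r' r'0 r'P] := h x (mem_head _ _).
exists (Num.min r r'); first by rewrite lt_min r0.
move=> y; rewrite inE => /orP[/eqP ->|ys].
  by apply: Pm r'P; rewrite ge_min lexx orbT.
by apply: Pm (rP y ys); rewrite ge_min lexx.
Qed.

Lemma separated (s : seq (R * \bar R)) : exists2 r, 0 < r &
  forall k, k \in s -> forall k', k' \in s -> close r k k' -> k = k'.
Proof.
apply: common_positive => [k r r' rr' H k' k's cl|k ks].
  by apply: H => //; exact: close_le cl.
apply: common_positive => [k' r r' rr' H cl|k' k's].
  by apply: H; exact: close_le cl.
have [h|/existsNP[e /not_implyP[e0 he]]] :=
  pselect (forall e, 0 < e -> close e k k').
  by exists 1 => // _; exact: close_eq.
by exists e.
Qed.

Lemma filter_forall_seq (T : Type) (U : eqType) (F : set_system T) (s : seq U)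
    (P : U -> set T) : Filter F -> (forall x, x \in s -> F (P x)) ->
  F [set t | forall x, x \in s -> P x t].
Proof.
move=> FF; elim: s => [|x s IHs] h; first by apply: filterS filterT.
have h1 := h x (mem_head _ _).
have h2 : F [set t | forall x, x \in s -> P x t].
  by apply: IHs => y ys; apply: h; rewrite inE ys orbT.
apply: filterS (filterI h1 h2) => t [Px Ps] y.
by rewrite inE => /orP[/eqP ->|/Ps].
Qed.

(** The limit is the supremum of the levels that [f] reaches on a set of [U]; as [U] is an
    ultrafilter, a level that is not reached is exceeded by no value of [f] on some set of [U]. *)
Lemma ultra_limit (T : Type) (U : set_system T) (f : T -> R) (x C : R) :
  UltraFilter U -> U [set t | `|x - f t| <= C] ->
  exists l, forall e, 0 < e -> U [set t | `|l - f t| <= e].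
Proof.
move=> UU Uf; have PU := ultra_proper.
pose A := [set y | U [set t | y <= f t]].
have A0 : A (x - C).
  by apply: filterS Uf => t /=; rewrite ler_norml => /andP[? ?]; lra.
have Aub : has_sup A.
  split; first by exists (x - C).
  exists (x + C) => y Ay.
  have [t [/= h]] := filter_ex (filterI Uf Ay).
  by move: h; rewrite ler_norml => /andP[? ?] ?; lra.
exists (sup A) => e e0.
have [y Ay ly] := sup_adherent e0 Aub.
have nA : ~ A (sup A + e).
  move=> h; have : sup A + e <= sup A by apply: ub_le_sup => //; apply: Aub.2.
  by lra.
have [//|h] := in_ultra_setVsetC [set t | sup A + e <= f t] UU.
apply: filterS (filterI Ay h) => t [/= h1 /negP].
by rewrite -ltNge => h2; rewrite ler_norml; apply/andP; split; lra.
Qed.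

Lemma ultra_seq (T : Type) (V : eqType) (U : set_system T) (f : T -> V)
    (s : seq V) : UltraFilter U -> U [set t | f t \in s] ->
  exists y, U [set t | f t = y].
Proof.
move=> UU; have PU := ultra_proper.
elim: s => [|y s IHs] h.
  by have [t] := filter_ex h.
have [h1|h1] := in_ultra_setVsetC [set t | f t = y] UU; first by exists y.
apply: IHs; apply: filterS (filterI h h1) => t [/=].
by rewrite inE => /orP[/eqP|].
Qed.

Definition matched (S : seq elt) p c : Prop := exists g : elt -> elt,
  (forall z, z \in S -> Dgm p (g z) /\ close c z.1 (g z).1) /\
  {in S &, injective g}.

End Matching.

(** * Following finitely many cornerpoints along a family *)

Section Tracking.
Context {R : realType}.
Implicit Types (c e t r h : R) (k : R * \bar R).
Local Notation elt := ((R * \bar R) * nat)%type.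

Context (q : R -> R -> \bar R -> int) (H c : R) (S : seq elt).
Context (qcpf : forall t, 0 <= t <= 1 -> cpf (q t)) (H0 : 0 < H) (Hc : H < c).
Context (qint : forall s t, 0 <= s <= 1 -> 0 <= t <= 1 -> s != t ->
  interleaved (`|s - t| * H) (q s) (q t)).
Context (Sfar : forall z, z \in S -> far c z.1).

Let c0 : 0 < c. Proof. exact: lt_trans H0 Hc. Qed.

(** Local counting at scale [(t' - t) H] gives each current position [k], within [(t' - t) c], as
    many cornerpoints of [q t'] as it has copies. Copy [n] moves to entry [n] of that list; lists of
    distinct positions stay disjoint for a short time. *)
Lemma matched_extends t : 0 <= t < 1 -> matched S (q t) (t * c) ->
  exists t', t < t' <= 1 /\ matched S (q t') (t' * c).
Proof.
move=> /andP[t0 t1] [g [gS ginj]].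
have t01 : 0 <= t <= 1 by rewrite t0 ltW.
have qt := qcpf t01.
have tcc : t * c <= c by rewrite ler_piMl // ltW.
pose K := [seq (g z).1 | z <- S].
have offK z : z \in S -> ((g z).1.1%:E < (g z).1.2)%E.
  move=> zS; apply: far_close (Sfar zS) _.
  exact: close_le tcc (gS z zS).2.
pose target t' k (s : seq elt) := [/\ uniq s,
  forall n, Dgm (q t) (k, n) -> (n < size s)%N &
  forall w, w \in s -> Dgm (q t') w /\ close ((t' - t) * c) k w.1].
have [rho rho0 sepK] := separated K.
have [eta eta0 etaP] : exists2 eta, 0 < eta & forall k, k \in K ->
    forall t', t < t' -> t' <= 1 -> t' <= t + eta -> exists s, target t' k s.
  apply: common_positive => [k r r' rr' h t' tt' t'1 t'r|k kK].
    by apply: h => //; lra.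
  have kk : (k.1%:E < k.2)%E by move/mapP: kK => [z zS ->]; exact: offK.
  have [r [m [r0 _ km L]]] := local_count qt kk ltr01.
  (* With [l = h = (t' - t) H] and [l' = (t' - t) c], this ensures [l' <= r - h]. *)
  exists (r / (c + c)) => [|t' tt' t'1 t'r]; first by rewrite divr_gt0 ?addr_gt0.
  have t'01 : 0 <= t' <= 1 by rewrite t'1 andbT; lra.
  have d0 : 0 < t' - t by rewrite subr_gt0.
  have dn : `|t - t'| = t' - t by rewrite distrC gtr0_norm.
  have tt'n : t != t' by rewrite lt_eqF.
  have I := qint t01 t'01 tt'n; rewrite dn in I.
  have dH0 : 0 < (t' - t) * H by rewrite mulr_gt0.
  have dHc : (t' - t) * H < (t' - t) * c by rewrite ltr_pM2l.
  have dcr : (t' - t) * (c + c) <= r.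
    by rewrite -ler_pdivlMr ?addr_gt0 //; lra.
  have [|s [us ss s1 s2]] := L _ _ _ _ (qcpf t'01) I dH0 (lexx _) dHc.
    by move: dcr; rewrite mulrDr; lra.
  exists s; split => //; rewrite ss => n D.
  by have /(Dgm_off n kk km) := D.
(* In order: [t + d] does not pass 1, local counting applies, and two distinct positions cannot
   share an image. *)
pose d := Num.min (1 - t) (Num.min eta (rho / (c + c))).
have d0 : 0 < d by rewrite !lt_min subr_gt0 t1 eta0 divr_gt0 ?addr_gt0.
have d1 : d <= 1 - t by rewrite ge_min lexx.
have d2 : d <= eta by rewrite !ge_min lexx orbT.
have d3 : d * c + d * c <= rho.
  by rewrite -mulrDr -ler_pdivlMr ?addr_gt0 // !ge_min lexx !orbT.
have [F FP] : {F : R * \bar R -> seq elt |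
    forall k, k \in K -> target (t + d) k (F k)}.
  have /choice[F FP] : forall k, exists s, k \in K -> target (t + d) k s.
    move=> k; have [kK|] := boolP (k \in K); last by exists [::].
    by have [||//|s sP] := etaP k kK (t + d); [lra|lra|lra|exists s].
  by exists F.
have inK z : z \in S -> (g z).1 \in K by move=> zS; apply/mapP; exists z.
have nth_in z : z \in S -> nth z (F (g z).1) (g z).2 \in F (g z).1.
  move=> zS; have [_ sF _] := FP _ (inK z zS); apply/mem_nth/sF.
  by have := (gS z zS).1; case: (g z).
have tdE : t + d - t = d by rewrite addrC addKr.
exists (t + d); split; first by apply/andP; split; lra.
exists (fun z => nth z (F (g z).1) (g z).2); split.
  move=> z zS; have [_ _ /(_ _ (nth_in z zS))[D cl]] := FP _ (inK z zS).
  split => //; rewrite mulrDl; apply: close_trans (gS z zS).2 _.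
  by rewrite tdE in cl.
move=> z w zS wS E.
have [uz sz /(_ _ (nth_in z zS))[_ clz]] := FP _ (inK z zS).
have [uw sw /(_ _ (nth_in w wS))[_ clw]] := FP _ (inK w wS).
rewrite -E in clw; rewrite tdE in clz clw.
have kk : (g z).1 = (g w).1.
  apply: sepK; rewrite ?inK //.
  exact: close_le d3 (close_trans clz (close_sym clw)).
apply: ginj => //; move: E uz sz sw (gS z zS).1 (gS w wS).1; rewrite -kk.
move: kk; case: (g z) (g w) => [k n] [k' n'] /= <- E us sz sw Dz Dw.
(* The two [nth] have defaults [z] and [w], harmless since both indices are in range. *)
rewrite (set_nth_default w) ?sz // in E.
by move/eqP: E; rewrite nth_uniq ?sz ?sw // => /eqP ->.
Qed.

(** Images converge along an ultrafilter of times increasing to [t0]. Points of [S] with a common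
    limit have distinct images near it at some time close to [t0], so local counting bounds their
    number by the multiplicity of the limit, and they receive distinct copies. *)
Lemma matched_limit t0 : uniq S -> 0 < t0 <= 1 ->
  (forall e, 0 < e -> exists t, [/\ t0 - e < t, t < t0, 0 <= t &
     matched S (q t) (t * c)]) ->
  matched S (q t0) (t0 * c).
Proof.
move=> uS /andP[t0_gt0 t0_le1] acc.
have t01 : 0 <= t0 <= 1 by rewrite t0_le1 ltW.
have qt := qcpf t01.
pose A := [set t | [/\ t < t0, 0 <= t & matched S (q t) (t * c)]].
pose B e := [set t | A t /\ t0 - e < t].
have [U [UU BU]] : exists U, UltraFilter U /\ (forall e, 0 < e -> U (B e)).
  pose F := filter_from [set e | 0 < e] B.
  have FF : ProperFilter F.
    apply: filter_from_proper; last first.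
      by move=> e /= /acc[t [h1 h2 h3 h4]]; exists t.
    apply: filter_from_filter; first by exists 1 => /=.
    move=> e e' e0 e'0; exists (Num.min e e') => /=; first by rewrite lt_min e0.
    have h1 : Num.min e e' <= e by rewrite ge_min lexx.
    have h2 : Num.min e e' <= e' by rewrite ge_min lexx orbT.
    by move=> t [At te]; split; split => //; lra.
  have [U [UU FU]] := ultraFilterLemma FF.
  by exists U; split => // e e0; apply: FU; exists e.
have PU := ultra_proper.
have [G GP] : {G : R -> elt -> elt | forall t, A t ->
    (forall z, z \in S -> Dgm (q t) (G t z) /\ close (t * c) z.1 (G t z).1) /\
    {in S &, injective (G t)}}.
  have /choice[G GP] : forall t, exists g : elt -> elt, A t ->
    (forall z, z \in S -> Dgm (q t) (g z) /\ close (t * c) z.1 (g z).1) /\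
    {in S &, injective g}.
    move=> t; have [[h1 h2 [g gP]]|nA] := pselect (A t); first by exists g.
    by exists id.
  by exists G.
have UA : U A by apply: filterS (BU 1 ltr01) => t [].
have tle t : A t -> t * c <= t0 * c.
  by move=> [tt0 _ _]; rewrite ler_pM2r // ltW.
have Gclose z : z \in S -> U [set t | close (t0 * c) z.1 (G t z).1].
  move=> zS; apply: filterS UA => t At.
  exact: close_le (tle t At) ((GP t At).1 z zS).2.
have /choice[kappa kP] : forall z, exists k, z \in S ->
    forall e, 0 < e -> U [set t | close e k (G t z).1].
  move=> z; have [zS|] := boolP (z \in S); last by exists z.1.
  have Gz := Gclose z zS.
  have [|x xP] := @ultra_limit _ _ U (fun t => (G t z).1.1) z.1.1 (t0 * c) UU.
    by apply: filterS Gz => t [].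
  have := Sfar zS; rewrite /far; case E : z.1.2 => [v||] // _.
    (* Closeness to the finite value [v] forces a finite second coordinate, so [fine] loses
       nothing. *)
    have [|y yP] := @ultra_limit _ _ U (fun t => fine (G t z).1.2) v (t0 * c) UU.
      apply: filterS Gz => t [_]; rewrite /= E.
      by case: (G t z).1.2.
    exists (x, y%:E) => _ e e0.
    apply: filterS (filterI Gz (filterI (xP e e0) (yP e e0))) => t [].
    move=> [_ /=]; rewrite E => h [/= h1 h2]; split => //=.
    by case: (G t z).1.2 h h2.
  exists (x, +oo%E) => _ e e0.
  apply: filterS (filterI Gz (xP e e0)) => t [].
  move=> [_ /=]; rewrite E => h h1; split => //=.
have kclose z : z \in S -> close (t0 * c) z.1 (kappa z).
  move=> zS; apply: close_inf => e e0.
  have [t [/= h1 h2]] := filter_ex (filterI (Gclose z zS) (kP z zS e e0)).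
  exact: close_trans h1 (close_sym h2).
have koff z : z \in S -> ((kappa z).1%:E < (kappa z).2)%E.
  move=> zS; apply: far_close (Sfar zS) (close_le _ (kclose z zS)).
  by rewrite ler_piMl // ltW.
pose fiber k := [seq w <- S | kappa w == k].
have fiberP z : z \in S -> exists m : nat,
    mult (q t0) (kappa z).1 (kappa z).2 m /\ (size (fiber (kappa z)) <= m)%N.
  move=> zS; have [r [m [r0 _ km L]]] := local_count qt (koff z zS) ltr01.
  exists m; split => //.
  (* The time is chosen so near [t0] that [h < r / 4]; then [l = r / 4] and [l' = r / 2] satisfy
     [l' <= r - h]. *)
  have r4 : 0 < r / 4 by rewrite divr_gt0.
  have e0 : 0 < r / 4 / c by rewrite divr_gt0.
  have UG : U [set t | forall w, w \in S -> close (r / 4) (kappa w) (G t w).1].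
    by apply: filter_forall_seq => w wS; exact: kP.
  have [t [[At te] /= tG]] := filter_ex (filterI (BU _ e0) UG).
  have [tt0 t0' _] := At.
  have tt01 : 0 <= t <= 1 by rewrite t0' /= (le_trans (ltW tt0)).
  have t0t : t0 != t by rewrite gt_eqF.
  have dn : `|t0 - t| = t0 - t by rewrite gtr0_norm // subr_gt0.
  have I := qint t01 tt01 t0t; rewrite dn in I.
  have dH0 : 0 < (t0 - t) * H by rewrite mulr_gt0 // subr_gt0.
  have dHr : (t0 - t) * H < r / 4.
    apply: (@lt_trans _ _ ((t0 - t) * c)).
      by rewrite ltr_pM2l // subr_gt0.
    by rewrite -ltr_pdivlMr //; lra.
  have [|||s [us ss _ sP]] := L _ _ (r / 4) (r / 2) (qcpf tt01) I dH0; try lra.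
  rewrite -ss -(size_map (G t)); apply: uniq_leq_size.
    rewrite map_inj_in_uniq ?filter_uniq // => x y.
    rewrite !mem_filter => /andP[_ xS] /andP[_ yS].
    exact: (GP t At).2.
  move=> y /mapP[w]; rewrite mem_filter => /andP[/eqP kw wS] ->.
  by apply: sP; [exact: ((GP t At).1 w wS).1|rewrite -kw; exact: tG].
exists (fun z => (kappa z, index z (fiber (kappa z)))); split.
  move=> z zS; split; last exact: kclose.
  have [m [km sm]] := fiberP z zS.
  apply/(Dgm_off _ (koff z zS) km); rewrite ltz_nat.
  by apply: leq_trans sm; rewrite index_mem mem_filter eqxx.
move=> z w zS wS [kk]; rewrite -kk => E.
have zf : z \in fiber (kappa z) by rewrite mem_filter eqxx.
have wf : w \in fiber (kappa z) by rewrite mem_filter -kk eqxx.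
by rewrite -(nth_index z zf) E nth_index.
Qed.

(** The supremum of the reachable times is reachable by [matched_limit], and by [matched_extends] it
    cannot be less than 1. *)
Lemma matched_along : uniq S -> (forall z, z \in S -> Dgm (q 0) z) ->
  matched S (q 1) c.
Proof.
move=> uS SD.
pose A := [set t | 0 <= t <= 1 /\ matched S (q t) (t * c)].
have A0 : A 0.
  split; first by rewrite lexx ler01.
  exists id; split => // z zS; split; first exact: SD.
  rewrite mul0r; apply: close_refl => //.
  by have := Sfar zS; rewrite /far; case: z.1.2.
have supA : has_sup A.
  by split; [exists 0|exists 1 => t [/andP[]]].
have sup01 : 0 <= sup A <= 1.
  apply/andP; split; first exact: (ub_le_sup supA.2).
  by apply: ge_sup; [exact: supA.1|move=> t [/andP[]]].
have Asup : A (sup A).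
  apply: contrapT => nA; apply: (nA); split => //.
  apply: matched_limit => //.
    have /andP[h1 ->] := sup01; rewrite andbT lt_neqAle h1 andbT.
    by apply/eqP => E; apply: nA; rewrite -E.
  move=> e e0; have [t At te] := sup_adherent e0 supA.
  have [/andP[t0 t1] mt] := At; exists t; split => //.
  rewrite lt_neqAle (ub_le_sup supA.2) // andbT.
  by apply/eqP => E; apply: nA; rewrite -E.
have [/andP[s0 s1] ms] := Asup.
have [s1'|s1'] := ltrP (sup A) 1.
  have [|t [/andP[st t1] mt]] := matched_extends _ ms; first by rewrite s0.
  have : t <= sup A by apply: (ub_le_sup supA.2); split => //; rewrite t1 andbT; lra.
  by rewrite leNgt st.
have E : sup A = 1 by apply/le_anti; rewrite s1.
by rewrite E mul1r in ms.
Qed.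

End Tracking.

(** * Injections between diagrams, and a bijection from them *)

Section Injections.
Context {R : realType}.
Implicit Types (p : R -> \bar R -> int) (c e t r : R) (k : R * \bar R).
Local Notation elt := ((R * \bar R) * nat)%type.

(** Countably many balls, with rational centres and radii [1 / (n + 1)], cover the off-diagonal
    points; those kept are far enough from the diagonal to contain finitely many. *)
Lemma off_countable p : cpf p -> exists i : elt -> nat,
  forall z w, Dgm p z -> (z.1.1%:E < z.1.2)%E ->
    Dgm p w -> (w.1.1%:E < w.1.2)%E -> i z = i w -> z = w.
Proof.
move=> pP; pose A := [set z | Dgm p z /\ (z.1.1%:E < z.1.2)%E].
suff /countable_injP[i iP] : countable A.
  by exists i => z w Dz zz Dw ww; apply: iP; apply/mem_set.
pose rad (n : nat) : R := n.+1%:R^-1.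
have rad0 n : 0 < rad n by rewrite invr_gt0.
pose pt (x : rat * option rat) : R * \bar R :=
  (ratr x.1, oapp (fun b : rat => (ratr b)%:E) +oo%E x.2).
pose N (x : rat * option rat * nat) :=
  [set z | Dgm p z /\ close (rad x.2) (pt x.1) z.1 /\ far (rad x.2) (pt x.1)].
have Nc : countable (\bigcup_(x in setT) N x).
  apply: bigcup_countable => [|x _]; first exact: countableP.
  have [fx|nfx] := pselect (far (rad x.2) (pt x.1)); last first.
    by apply: (sub_countable (B := set0)) => //; apply: subset_card_le => z [_ []].
  have [s sP] := diagram_finite_near pP (rad0 x.2) fx.
  apply: (sub_countable (B := [set` s])).
    by apply: subset_card_le => z [D [cl _]]; exact: sP.
  exact/finite_set_countable/finite_seq.
apply: sub_countable Nc; apply: subset_card_le => -[[u v] i] [D /= uv].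
have small e : 0 < e -> exists n, rad n < e.
  move=> e0; exists (Num.truncn e^-1).
  by rewrite /rad invf_plt ?posrE // truncnS_gt.
case: v D uv => [v||] // D; rewrite ?lte_fin => uv.
(* A radius below a quarter of the persistence leaves the rational centre with persistence above
   twice the radius. *)
- have [|n ne] := small ((v - u) / 4); first by rewrite divr_gt0 ?subr_gt0.
  have rn := rad0 n.
  have [a] := @rat_in_itvoo R u (u + rad n) ltac:(lra).
  rewrite in_itv /= => /andP[ua au].
  have [b] := @rat_in_itvoo R (v - rad n) v ltac:(lra).
  rewrite in_itv /= => /andP[vb bv].
  exists (a, Some b, n) => //; split => //; split; last first.
    by rewrite /far /= lte_fin; lra.
  by split => /=; rewrite ler_norml; apply/andP; split; lra.
- have rn := rad0 0.
  have [a] := @rat_in_itvoo R u (u + rad 0) ltac:(lra).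
  rewrite in_itv /= => /andP[ua au].
  exists (a, None, 0) => //; split => //; split; last by rewrite /far /= ltry.
  by split => //=; rewrite ler_norml; apply/andP; split; lra.
Qed.

Section Family.
Context (q : R -> R -> \bar R -> int) (H c : R).
Context (qcpf : forall t, 0 <= t <= 1 -> cpf (q t)) (H0 : 0 < H) (Hc : H < c).
Context (qint : forall s t, 0 <= s <= 1 -> 0 <= t <= 1 -> s != t ->
  interleaved (`|s - t| * H) (q s) (q t)).

Let c0 : 0 < c. Proof. exact: lt_trans H0 Hc. Qed.

Let q0 : cpf (q 0). Proof. by apply: qcpf; rewrite lexx ler01. Qed.

Let q1 : cpf (q 1). Proof. by apply: qcpf; rewrite lexx ler01. Qed.

Lemma far_off k : far c k -> (k.1%:E < k.2)%E.
Proof.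
move=> fk; apply: (far_close fk (close_refl (ltW c0) _)).
by move: fk; rewrite /far; case: k.2.
Qed.

(* Injections of larger and larger finite parts are glued along an
   ultrafilter: every point has only finitely many possible images. *)
Lemma far_injection : exists g : elt -> elt,
  (forall z, Dgm (q 0) z -> far c z.1 ->
     Dgm (q 1) (g z) /\ close c z.1 (g z).1) /\
  (forall z w, Dgm (q 0) z -> far c z.1 -> Dgm (q 0) w -> far c w.1 ->
     g z = g w -> z = w).
Proof.
have [i iP] := off_countable q0.
(* The code [i] is injective on these points, so each increase of [n] adds at most one of them. *)
have [S SP] : {S : nat -> seq elt | forall n, uniq (S n) /\
    forall z, z \in S n <-> [/\ Dgm (q 0) z, far c z.1 & (i z < n)%N]}.
  have /choice[S SP] : forall n, exists s : seq elt, uniq s /\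
      forall z, z \in s <-> [/\ Dgm (q 0) z, far c z.1 & (i z < n)%N].
    elim=> [|n [s [us sP]]]; first by exists [::]; split => // z; split => // -[].
    have [[z [Dz fz iz]]|nz] :=
      pselect (exists z, [/\ Dgm (q 0) z, far c z.1 & i z = n]).
      exists (z :: s); split.
        by rewrite /= us andbT; apply/negP => /sP[_ _]; rewrite iz ltnn.
      move=> w; rewrite inE; split.
        move=> /orP[/eqP ->|/sP[? ? ?]]; first by split => //; rewrite iz.
        by split => //; exact: ltnW.
      move=> [Dw fw]; rewrite ltnS leq_eqVlt => /orP[/eqP iw|iw].
        apply/orP; left; apply/eqP/iP => //; try exact: far_off.
        by rewrite iw.
      by apply/orP; right; apply/sP.
    exists s; split => // w; split.
      by move=> /sP[? ? ?]; split => //; exact: ltnW.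
    move=> [Dw fw]; rewrite ltnS leq_eqVlt => /orP[/eqP iw|iw]; last exact/sP.
    by exfalso; apply: nz; exists w.
  by exists S.
have /choice[G GP] : forall n, matched (S n) (q 1) c.
  move=> n; apply: (matched_along qcpf H0 Hc qint); last 2 first.
  - exact: (SP n).1.
  - by move=> z /(SP n).2[].
  - by move=> z /(SP n).2[].
have [U [UU sU]] := ultraFilterLemma (@eventually_filter).
have PU := ultra_proper.
have inS z : Dgm (q 0) z -> far c z.1 -> U [set n | z \in S n].
  move=> Dz fz; apply: sU; exists (i z).+1 => // n /= izn.
  by apply/(SP n).2.
have /choice[g gP] : forall z, exists y, Dgm (q 0) z -> far c z.1 ->
    U [set n | G n z = y].
  move=> z; have [Dz|nD] := pselect (Dgm (q 0) z); last by exists z.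
  have [fz|nf] := pselect (far c z.1); last by exists z.
  have [s sP] := diagram_finite_near q1 c0 fz.
  have [|y Uy] := @ultra_seq _ _ U (fun n => G n z) s UU; last by exists y.
  apply: filterS (inS z Dz fz) => n /= zn.
  by have [D cl] := (GP n).1 z zn; exact: sP.
exists g; split.
  move=> z Dz fz.
  have [n [/= zn <-]] := filter_ex (filterI (inS z Dz fz) (gP z Dz fz)).
  exact: (GP n).1.
move=> z w Dz fz Dw fw E.
have [n [[/= zn wn] [gz gw]]] := filter_ex (filterI
  (filterI (inS z Dz fz) (inS w Dw fw)) (filterI (gP z Dz fz) (gP w Dw fw))).
by apply: (GP n).2 => //; rewrite gz gw E.
Qed.

(** Off-diagonal points that are not far have persistence at most [2c], so their midpoint on the
    diagonal is within [c]. *)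
Lemma diagram_injection : exists g : elt -> elt,
  (forall z, Dgm (q 0) z -> Dgm (q 1) (g z) /\ close c z.1 (g z).1) /\
  (forall z w, Dgm (q 0) z -> Dgm (q 0) w -> g z = g w -> z = w).
Proof.
have [g [gP ginj]] := far_injection.
have [i iP] := off_countable q0.
pose mid (z : elt) : R := (z.1.1 + fine z.1.2) / 2.
(* Diagonal points use the even copies and projected points the odd ones, the latter told apart by
   the code [i], so that no images collide. *)
pose f (z : elt) : elt := if z.1.2 == z.1.1%:E then (z.1, z.2.*2)
  else if `[< far c z.1 >] then g z else ((mid z, (mid z)%:E), (i z).*2.+1).
have off z : Dgm (q 0) z -> z.1.2 != z.1.1%:E -> (z.1.1%:E < z.1.2)%E.
  by move=> [/eqP ->|[]].
have goff z : Dgm (q 0) z -> far c z.1 -> (g z).1.2 != (g z).1.1%:E.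
  move=> Dz fz; have [_ cl] := gP z Dz fz.
  by rewrite gt_eqF //; exact: far_close fz cl.
exists f; split.
  move=> z Dz; rewrite /f; case: ifPn => [/eqP zd|nzd].
    split; first by left.
    by apply: close_refl; [exact: ltW|rewrite zd].
  case: asboolP => [fz|nfz]; first exact: gP.
  split; first by left.
  have := off z Dz nzd; move: nfz; rewrite /far /close /mid /=.
  case: z.1.2 => [v||] //; last by rewrite ltry.
  rewrite !lte_fin => /negP; rewrite -leNgt /= => h1 h2.
  by rewrite !ler_norml; split; apply/andP; split; lra.
move=> z w Dz Dw; rewrite /f.
have [zd|nzd] := eqVneq z.1.2 z.1.1%:E; have [wd|nwd] := eqVneq w.1.2 w.1.1%:E.
- move: z w {Dz Dw zd wd} => [z1 z2] [w1 w2] [/= -> E]; congr (_, _).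
  by apply: double_inj.
- case: asboolP => [fw|nfw].
    by move=> E; move: (goff w Dw fw); rewrite -E /= zd eqxx.
  by move=> [_ E]; move/(congr1 odd): E; rewrite /= !odd_double.
- case: asboolP => [fz|nfz].
    by move=> E; move: (goff z Dz fz); rewrite E /= wd eqxx.
  by move=> [_ E]; move/(congr1 odd): E; rewrite /= !odd_double.
- case: asboolP => [fz|nfz]; case: asboolP => [fw|nfw].
  + exact: ginj.
  + by move=> E; move: (goff z Dz fz); rewrite E /= eqxx.
  + by move=> E; move: (goff w Dw fw); rewrite -E /= eqxx.
  + by move=> [_ _ E]; apply: iP; [..|exact: double_inj]; rewrite ?off.
Qed.

End Family.

(** Each [h x] is either [f x] or a preimage of [x] under [g], and both are related to [x]; hence
    the bijection inherits the distance bound. *)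
Lemma Cantor_Bernstein_related (T U : Type) (A : set T) (B : set U)
    (rel : T -> U -> Prop) (f : T -> U) (g : U -> T) :
  (forall x, A x -> B (f x) /\ rel x (f x)) ->
  (forall y, B y -> A (g y) /\ rel (g y) y) ->
  (forall x x', A x -> A x' -> f x = f x' -> x = x') ->
  (forall y y', B y -> B y' -> g y = g y' -> y = y') ->
  exists h : T -> U, [/\ forall x, A x -> B (h x) /\ rel x (h x),
    forall x x', A x -> A x' -> h x = h x' -> x = x' &
    forall y, B y -> exists x, A x /\ h x = y].
Proof.
move=> fP gP finj ginj.
(* [C] is the union of the orbits under [g \o f] that start outside the image of [g]; [h] is [f] on
   [C] and inverts [g] elsewhere. *)
pose C x := exists n a, [/\ A a, ~ (exists b, B b /\ g b = a) &
  x = iter n (g \o f) a].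
have CA x : C x -> A x.
  move=> [n [a [Aa _ ->]]]; elim: n => //= n IHn.
  exact: (gP _ (fP _ IHn).1).1.
have Cgf x : C x -> C (g (f x)).
  by move=> [n [a [Aa h ->]]]; exists n.+1, a.
have CB y : B y -> C (g y) -> exists x, C x /\ f x = y.
  move=> By [[|n] [a [Aa h /= E]]]; first by case: h; exists y.
  have Cn : C (iter n (g \o f) a) by exists n, a.
  exists (iter n (g \o f) a); split => //; apply/esym/ginj => //.
  exact: (fP _ (CA _ Cn)).1.
have [h hP] : {h : T -> U | forall x, A x ->
    (C x -> h x = f x) /\ (~ C x -> B (h x) /\ g (h x) = x)}.
  have /choice[h hP] : forall x, exists y, A x ->
      (C x -> y = f x) /\ (~ C x -> B y /\ g y = x).
    move=> x; have [Cx|nCx] := pselect (C x); first by exists (f x).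
    have [[y yP]|ny] := pselect (exists b, B b /\ g b = x); first by exists y.
    by exists (f x) => Ax; split => // _; exfalso; apply: nCx; exists 0, x.
  by exists h.
exists h; split.
- move=> x Ax; have [h1 h2] := hP x Ax; have [/h1 ->|/h2[Bh gh]] := pselect (C x).
    exact: fP.
  by split => //; have [_] := gP _ Bh; rewrite gh.
- move=> x x' Ax Ax' E; have [h1 h2] := hP x Ax; have [h1' h2'] := hP x' Ax'.
  have [Cx|nCx] := pselect (C x); have [Cx'|nCx'] := pselect (C x').
  + by apply: finj => //; rewrite -h1 // -h1'.
  + exfalso; apply: (nCx'); have [_ <-] := h2' nCx'.
    by rewrite -E h1 //; exact: Cgf.
  + exfalso; apply: (nCx); have [_ <-] := h2 nCx.
    by rewrite E h1' //; exact: Cgf.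
  + by have [_ <-] := h2 nCx; have [_ <-] := h2' nCx'; rewrite E.
- move=> y By; have [Agy _] := gP y By; have [Cgy|nCgy] := pselect (C (g y)).
    have [x [Cx <-]] := CB y By Cgy; exists x; split; first exact: CA.
    exact: (hP x (CA x Cx)).1.
  have [Bh gh] := (hP _ Agy).2 nCgy.
  by exists (g y); split => //; apply: ginj.
Qed.

Lemma pdist_close c k k' : 0 <= c -> close c k k' -> (pdist k k' <= c%:E)%E.
Proof.
move=> c0; rewrite /close /pdist ge_max => -[h1 h2].
apply/andP; split; first by rewrite lee_fin.
by move: h2; rewrite /edist; case: k.2 k'.2 => [v||] [v'||].
Qed.

Lemma bottleneck_family (q : R -> R -> \bar R -> int) (H c : R) :
  (forall t, 0 <= t <= 1 -> cpf (q t)) -> 0 < H -> H < c ->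
  (forall s t, 0 <= s <= 1 -> 0 <= t <= 1 -> s != t ->
    interleaved (`|s - t| * H) (q s) (q t)) ->
  (bottleneck (Dgm (q 0%R)) (Dgm (q 1%R)) <= c%:E)%E.
Proof.
move=> qP H0 Hc qI; have c0 := lt_trans H0 Hc.
have [f [fP finj]] := diagram_injection qP H0 Hc qI.
(* The reversed family gives the injection from the second diagram to the first. *)
have [|s t s01 t01 st|g [gP ginj]] :=
  @diagram_injection (fun t => q (1 - t)) H c _ H0 Hc _.
- by move=> t /andP[? ?]; apply: qP; apply/andP; split; lra.
- have -> : `|s - t| = `|(1 - s) - (1 - t)|.
    by rewrite distrC; congr (`| _ |); lra.
  move: s01 t01 => /andP[? ?] /andP[? ?].
  apply: qI; [apply/andP; split; lra|apply/andP; split; lra|].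
  by apply: contra_neq st; lra.
rewrite subr0 subrr in gP ginj.
have [|h [hP hinj hsurj]] := @Cantor_Bernstein_related _ _ _ _
    (fun z w => close c z.1 w.1) f g fP _ finj ginj.
  by move=> y /gP[? ?]; split => //; exact: close_sym.
apply: (@le_trans _ _ (ereal_sup [set pdist z.1 (h z).1 | z in Dgm (q 0)])).
  apply: ereal_inf_lbound; exists h; split => // z Dz.
  exact: (hP z Dz).1.
apply: ge_ereal_sup => _ [z Dz <-].
exact: pdist_close (ltW c0) (hP z Dz).2.
Qed.

End Injections.

(** * Weighted graphs and the interpolating path *)

Section Graphs.
Context {R : realType}.
Implicit Types (G : wgraph R).

Definition graph_close (d : R) G1 G2 : Prop :=
  exists psi : vtx G1 -> vtx G2, giso G1 G2 psi /\
    forall e, is_edge G1 e -> `|wt G1 e - wt G2 (psi @: e)%SET| <= d.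

Lemma graph_close_refl G : graph_close 0 G G.
Proof.
exists id; split; first by split => //; exists id.
by move=> e _; rewrite imset_id subrr normr0.
Qed.

Lemma giso_edge G1 G2 psi e : giso G1 G2 psi -> is_edge G1 e ->
  is_edge G2 (psi @: e)%SET.
Proof.
move=> [_ h] [x [y [xy ->]]]; exists (psi x), (psi y).
by rewrite h imsetU1 imset_set1.
Qed.

Lemma graph_close_sym d G1 G2 : graph_close d G1 G2 -> graph_close d G2 G1.
Proof.
move=> [psi [[[phi pK kP] psiA] h]]; exists phi.
have phiA : giso G2 G1 phi.
  by split; [exists psi|move=> x y; rewrite -psiA !kP].
split => // e eE; rewrite distrC.
have := h _ (giso_edge phiA eE); congr (`|_ - wt G2 _| <= d).
by rewrite -imset_comp (eq_imset _ (kP : psi \o phi =1 id)) imset_id.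
Qed.

Lemma graph_close_trans d d' G1 G2 G3 :
  graph_close d G1 G2 -> graph_close d' G2 G3 -> graph_close (d + d') G1 G3.
Proof.
move=> [f [fI fP]] [g [gI gP]]; exists (g \o f).
split.
  split; first exact: bij_comp gI.1 fI.1.
  by move=> x y /=; rewrite gI.2 fI.2.
move=> e eE; rewrite imset_comp.
apply: le_trans (ler_distD (wt G2 (f @: e)%SET) _ _) _.
by apply: lerD; [exact: fP|apply: gP; exact: giso_edge fI eE].
Qed.

Definition interp G G' (psi : vtx G -> vtx G') (t : R) : wgraph R :=
  @WGraph R (vtx G) (adj G) (@adj_sym R G) (@adj_irr R G)
    (fun e => (1 - t) * wt G e + t * wt G' (psi @: e)%SET).

Lemma graph_close_interp G G' psi (d s t : R) :
  (forall e, is_edge G e -> `|wt G e - wt G' (psi @: e)%SET| <= d) ->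
  graph_close (`|s - t| * d) (@interp G G' psi s) (interp psi t).
Proof.
move=> h; exists id; split; first by split => //; exists id.
move=> e eE; rewrite imset_id /=.
have -> : (1 - s) * wt G e + s * wt G' (psi @: e)%SET -
    ((1 - t) * wt G e + t * wt G' (psi @: e)%SET) =
    - ((s - t) * (wt G e - wt G' (psi @: e)%SET)) by lra.
by rewrite normrN normrM ler_wpM2l // h.
Qed.

Lemma graph_close_interp0 G G' psi : graph_close 0 (@interp G G' psi 0) G.
Proof.
exists id; split; first by split => //; exists id.
move=> e eE; rewrite imset_id /= subr0 mul1r mul0r addr0 subrr.
by rewrite normr0.
Qed.

Lemma graph_close_interp1 G G' psi : giso G G' psi -> graph_close 0 (interp psi 1) G'.
Proof.
move=> psiI; exists psi; split; first by [].
move=> e eE /=; rewrite subrr mul0r mul1r add0r subrr.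
by rewrite normr0.
Qed.

(** Balancedness gives one inequality, and applied to the inverse isomorphism the other. *)
Lemma graph_close_interleaved (p : forall G, R -> \bar R -> int) d G1 G2 :
  balanced p -> 0 < d -> graph_close d G1 G2 -> interleaved d (p G1) (p G2).
Proof.
move=> pb d0 G12 u v uv; have [f [fI fP]] := G12.
have [g [gI gP]] := graph_close_sym G12.
by split; [exact: (pb _ _ f fI d d0 fP u v%:E)|exact: (pb _ _ g gI d d0 gP u v%:E)].
Qed.

(* The endpoints of the path are replaced by [G] and [G'] themselves, so that
   no identification of isomorphic weighted graphs is needed. *)
Definition path_graph G G' (psi : vtx G -> vtx G') (t : R) : wgraph R :=
  if t == 0 then G else if t == 1 then G' else interp psi t.

Lemma graph_close_path_graph G G' psi (d s t : R) : giso G G' psi ->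
  (forall e, is_edge G e -> `|wt G e - wt G' (psi @: e)%SET| <= d) ->
  graph_close (`|s - t| * d) (path_graph psi s) (path_graph psi t).
Proof.
move=> psiI h.
have np r : graph_close 0 (interp psi r) (path_graph psi r).
  rewrite /path_graph; case: eqP => [->|_]; first exact: graph_close_interp0.
  by case: eqP => [->|_]; [exact: graph_close_interp1|exact: graph_close_refl].
have := graph_close_trans (graph_close_trans (graph_close_sym (np s)) (graph_close_interp s t h)) (np t).
by rewrite add0r addr0.
Qed.

Lemma bottleneck_giso (p : forall G, R -> \bar R -> int) G G' psi (d : R) :
  ip_generator p -> balanced p -> giso G G' psi -> 0 <= d ->
  (forall e, is_edge G e -> `|wt G e - wt G' (psi @: e)%SET| <= d) ->
  (bottleneck (Dgm (p G)) (Dgm (p G')) <= d%:E)%E.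
Proof.
move=> [pc _] pb psiI d0 h; apply/lee_addgt0Pr => e e0.
(* [d] may be 0 whereas tracking needs [0 < H < c]; the slack [e] makes room for [H = d + e / 2] and
   [c = d + e]. *)
have H0 : 0 < d + e / 2 by lra.
have Hc : d + e / 2 < d + e by lra.
have := @bottleneck_family R (fun t => p (path_graph psi t)) _ _ _ H0 Hc.
rewrite /path_graph eqxx oner_eq0 eqxx; apply => [t _|s t _ _ st]; first exact: pc.
apply: graph_close_interleaved => //; first by rewrite mulr_gt0 // normr_gt0 subr_eq0.
apply: graph_close_path_graph => // x xE.
by apply: le_trans (h x xE) _; lra.
Qed.

End Graphs.

Theorem theorem1 (R : realType) (p : forall G : wgraph R, R -> \bar R -> int)
  (Hp : ip_generator p) (Hb : balanced p) (G G' : wgraph R) :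
  (bottleneck (Dgm (p G)) (Dgm (p G')) <= nat_pseudodist G G')%E.
Proof.
rewrite /nat_pseudodist; case: asboolP => [_|_]; last exact: leey.
apply: le_ereal_inf_tmp => _ [psi [psiI ->]].
set c := ereal_sup _.
have c0 : (0 <= c)%E by apply: ereal_sup_ubound; left.
have cP e : is_edge G e -> ((`|wt G e - wt G' (psi @: e)%SET|)%:E <= c)%E.
  by move=> eE; apply: ereal_sup_ubound; right; exists e.
(* Being nonnegative, [c] is either a real [d] or [+oo], and in the latter case the bound is
   trivial. *)
case: c c0 cP => [d||] // => [|_ _]; last exact: leey.
rewrite lee_fin => d0 dP.
apply: (bottleneck_giso Hp Hb psiI d0) => e eE.
by rewrite -lee_fin; exact: dP.
Qed.
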